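(* Let $S\subset\mathbb R$ be finite and let $(Z_n)$ be a stochastic process whose law is a one-dimensional Gibbs measure on $S^{\mathbb Z}$ for a shift-invariant potential $\Phi=\{\phi_A: A\subset\mathbb Z,\ 0<|A|<\infty\}$. Assume that for all odd numbers $k$ and all $i_1,\dots,i_k$ we have $\mathbb E(Z_{i_1}Z_{i_2}\cdots Z_{i_k})=0$, and that $\mathbb E(Z_i^2)=1$ for all $i\in\mathbb N$. Moreover, assume that Dobrushin's condition $$\sum_{A:\,0\in A}(|A|-1)\sup_{\zeta,\eta}|\phi_A(\zeta)-\phi_A(\eta)|<2$$ holds, and that for some $t>0$ $$\sum_{A:\,0\in A}e^{t\,\mathrm{diam}(A)}(|A|-1)\sup_{\zeta,\eta}|\phi_A(\zeta)-\phi_A(\eta)|<\infty.$$ Then for all even $k$ there are constants $C>0$ and $\beta\in[0,1)$ such that for all $i_1\le i_2\le\dots\le i_k$, with $n_j:=i_{j+1}-i_j$, $$|\mathbb E(Z_{i_1}Z_{i_2}\cdots Z_{i_k})|\le C\beta^{n_1+n_3+\dots+n_{k-1}},$$ and for all $j_1\le\dots\le j_k$, with $d:=\min_{n,m\in\{1,\dots,k\}}|i_n-j_m|$, $$|\mathbb E(Z_{i_1}\cdots Z_{i_k}Z_{j_1}\cdots Z_{j_k})-\mathbb E(Z_{i_1}\cdots Z_{i_k})\,\mathbb E(Z_{j_1}\cdots Z_{j_k})|\le C\beta^{d}.$$ Moreover, for $d':=\min_{j=1,3,5,\dots,k-3}(i_{j+2}-i_j)$, $$|\mathbb E(Z_{i_1}^2Z_{i_3}^2\cdots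 Z_{i_{k-1}}^2)-1|\le C\beta^{d'}.$$
   Context: Gibbs measures are in the sense of Georgii's book ''Gibbs Measures and Phase Transitions''. A potential $\Phi$ is a family of functions $\phi_A:S^{\mathbb Z}\to\mathbb R$, indexed by finite non-empty $A\subset\mathbb Z$, with $\phi_A(\omega)$ depending only on $(\omega_i)_{i\in A}$, such that for every finite $\Lambda\subset\mathbb Z$ the Hamiltonian $H_\Lambda(\omega)=\sum_{A:A\cap\Lambda\ne\emptyset}\phi_A(\omega)$ exists. It is shift-invariant if $\phi_{A+j}(\omega)=\phi_A((\omega_{i+j})_{i\in\mathbb Z})$ for all $j\in\mathbb Z$. A probability measure on $S^{\mathbb Z}$ is a Gibbs measure for $\Phi$ if for every finite $\Lambda$ the conditional probability of the configuration $\zeta$ on $\Lambda$ given the configuration $\omega$ outside $\Lambda$ is proportional to $\exp(-H_\Lambda(\zeta\,\omega_{\Lambda^c}))$. $Z_n$ is the $n$-th coordinate; only indices $n\in\mathbb N$ are used in the moments. $\mathrm{diam}(A)=\max A-\min A$; the suprema are over $\zeta,\eta\in S^{\mathbb Z}$. The constants $C,\beta$ may depend on $k$ and on the measure but not on the indices. Conventions: $0^0=1$; for $k=2$ the minimum defining $d'$ is empty and the last estimate is just $\mathbb E(Z_{i_1}^2)=1$. *)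

(* Defs.v *)
From HB Require Import structures.
From mathcomp Require Import all_boot all_order all_algebra finmap.
From mathcomp Require Import all_classical all_reals all_analysis.
From mathcomp.analysis.showcase Require Import summability.

Set Implicit Arguments.
Unset Strict Implicit.
Unset Printing Implicit Defensive.

Import Order.TTheory GRing.Theory Num.Theory.
Import numFieldNormedType.Exports.

Local Open Scope classical_set_scope.
Local Open Scope ring_scope.

(* Minimum and maximum of a non-empty list; x0 is only used for [::]. *)
Definition seq_min d (T : orderType d) (x0 : T) (s : seq T) : T :=
  \big[Order.min/head x0 s]_(x <- s) x.
Definition seq_max d (T : orderType d) (x0 : T) (s : seq T) : T :=
  \big[Order.max/head x0 s]_(x <- s) x.

Definition diam (A : {fset int}) : int := seq_max 0 A - seq_min 0 A.

Definition coord_events (S : Type) (I : set int) : set_system (int -> S) :=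
  [set [set w | w i = s] | i in I & s in [set: S]].
Arguments coord_events S I : clear implicits.

(* The space S^Z with its product sigma-algebra. Measurable types have to be
   pointed, hence the dependence on a proof that S is not empty. *)
Definition config (R : realType) (S : {fset R}) (hS : S != fset0) : Type :=
  int -> S.

Section config_measurable.
Variables (R : realType) (S : {fset R}) (hS : S != fset0).

Let s0 : S := [` xchooseP (elimT (fset0Pn S) hS)]%fset.

HB.instance Definition _ := Choice.copy (config hS) (int -> S).
HB.instance Definition _ := isPointed.Build (config hS) (fun=> s0).
HB.instance Definition _ :=
  @isMeasurable.Build (sigma_display (coord_events S setT)) (config hS)
    <<s coord_events S setT >>
    (@sigma_algebra0 _ setT _)
    (@sigma_algebraC (config hS) (coord_events S setT))
    (@sigma_algebra_bigcup _ setT _).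

End config_measurable.

(* The value at the empty set is never used. *)
Definition interaction (R : realType) (S : {fset R}) : Type :=
  {fset int} -> (int -> S) -> R.

Section potentials.
Variables (R : realType) (S : {fset R}) (phi : interaction S).
Implicit Types (A L D : {fset int}) (w : int -> S).

(* As in Georgii's book, the sum over all A meeting L is the limit of the sums
   over A included in D along the net of finite D directed by inclusion;
   absolute convergence is not required. *)
Definition hamiltonian_part L w D : R :=
  \sum_(A <- fpowerset D | ~~ [disjoint A & L]%fset) phi A w.

Definition hamiltonian L w : R := lim (hamiltonian_part L w @ totally).

Definition is_potential : Prop :=
  (forall A w w', A != fset0 -> (forall i, i \in A -> w i = w' i) ->
     phi A w = phi A w') /\
  (forall L w, cvg (hamiltonian_part L w @ totally)).

Definition shift_invariant : Prop :=
  forall A (j : int) w, A != fset0 ->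
    phi [fset (a + j)%R | a in A]%fset w = phi A (fun i => w (i + j)).

Definition oscillation A : \bar R :=
  ereal_sup [set (`|phi A w.1 - phi A w.2|)%:E
            | w in [set: (int -> S) * (int -> S)]].

(* The configuration equal to z on L and to w outside L. *)
Definition splice L (z : {ffun L -> S}) w : int -> S :=
  fun i => if insub i is Some l then z l else w i.

Definition gibbs_density L (z : {ffun L -> S}) w : R :=
  expR (- hamiltonian L (splice z w)) /
  \sum_(y : {ffun L -> S}) expR (- hamiltonian L (splice y w)).

End potentials.

(* f is a version of the conditional probability of E given the
   sigma-algebra G. *)
Definition is_cond_prob d (T : measurableType d) (R : realType)
    (P : probability T R) (G : set_system T) (E : set T) (f : T -> R) : Prop :=
  (forall Y : set R, measurable Y -> G (f @^-1` Y)) /\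
  (forall B, G B -> P (E `&` B) = (\int[P]_(x in B) (f x)%:E)%E).

Definition is_gibbs (R : realType) (S : {fset R}) (hS : S != fset0)
    (phi : interaction S) (mu : probability (config hS) R) : Prop :=
  forall (L : {fset int}) (z : {ffun L -> S}),
    is_cond_prob mu <<s coord_events S [set i | i \notin L] >>
      [set w | forall l : L, w (val l) = z l] (gibbs_density phi z).

Definition spin (R : realType) (S : {fset R}) (hS : S != fset0) (n : nat)
    (w : config hS) : R := val (w n%:Z).

Definition moment (R : realType) (S : {fset R}) (hS : S != fset0)
    (mu : probability (config hS) R) (i : seq nat) : \bar R :=
  ('E_mu[fun w => (\prod_(n <- i) spin n w)%R])%E.

(* Indices in lists are numbered from 0, so that i_{a+1} is nth 0 i a, and
   i_{2a+1} is nth 0 i a.*2. *)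
Definition odd_gaps (i : seq nat) : nat :=
  \sum_(0 <= a < (size i)./2) (nth 0 i a.*2.+1 - nth 0 i a.*2)%N.

Definition index_dist (i j : seq nat) : nat :=
  seq_min 0%N [seq absz (n%:Z - m%:Z) | n <- i, m <- j].

Definition odd_spacing (i : seq nat) : nat :=
  seq_min 0%N [seq (nth 0 i a.+1.*2 - nth 0 i a.*2)%N
              | a <- iota 0 (size i)./2.-1].

(* Main.v *)
Require Import Defs.
From mathcomp Require Import all_boot all_order all_algebra finmap.
From mathcomp Require Import all_classical all_reals all_analysis.
From mathcomp Require Import measurable_realfun ring lra zify.
From mathcomp.analysis.showcase Require Import summability.

Set Implicit Arguments.
Unset Strict Implicit.
Unset Printing Implicit Defensive.

Import Order.TTheory GRing.Theory Num.Theory.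
Import numFieldNormedType.Exports.

Local Open Scope classical_set_scope.
Local Open Scope ring_scope.

(** Exponential decay of correlations under Dobrushin's condition, and its
    consequences for the moments of the spins.

    All three estimates say that some covariance of two products of spins is
    exponentially small in the distance between the two sets of indices. For
    the first one, cut the index sequence at its largest odd gap: on either side
    there is an odd number of spins, whose expectation vanishes, so the moment
    is itself a covariance, and the largest odd gap is at least a fixed fraction
    of the sum of the odd gaps. The second estimate is literally a covariance.
    For the third one, remove the squares one at a time, each at the price of
    one covariance because the expectation of a square is [1]. Hence everything
    follows from [covariance_decay].

    That theorem is proved with a weighted form of Dobrushin's contraction.
    An observable [h] is measured by numbers [a j] that bound its change when
    the spin at [j] changes ([site_lipschitz]). Replacing [h] by its conditional
    expectation given all spins except the one at [i] ([heat_bath]) does not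
    change its expectation against observables that ignore [i]
    ([heat_bath_invariance]); it sets [a i] to [0] and adds to every other
    [a j] at most [a i] times half the coupling between [i] and [j], the sum of
    the oscillations of the interaction over the sets that contain both
    ([heat_bath_lipschitz]). Under the two summability hypotheses the couplings
    of a site, weighted by [e ^ (th * distance)], still add up to less than [2]
    for a small [th > 0] ([weighted_coupling_lt]). Hence if the numbers [a j]
    are added up with a weight that grows at most like [e ^ (th * distance)],
    every resampling decreases the weighted sum by a fixed fraction of the term
    at [i] ([weighted_sum_heat_bath]).

    Now let [f] live on [I] and [g] at distance at least [d] from [I], and let
    the weight be about [e ^ (th * distance to I)]. Resampling again and again
    the sites at distance less than [d] from [I] preserves the covariance of [f]
    with [g] and never increases the weighted sum, and it makes the terms at
    those sites arbitrarily small ([exists_small_substitute]). All the other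
    sites have a weight of order [e ^ (th * d)], so the observable that replaces
    [f] has a total oscillation of order [e ^ (- th * d)], which bounds the
    covariance. *)

(** * Finite Gibbs distributions *)

Lemma tanh_le_id (R : realType) (y : R) : 0 <= y ->
  expR (2 * y) - 1 <= y * (expR (2 * y) + 1).
Proof.
move=> y0; pose f (x : R) := x * (expR (2 * x) + 1) - expR (2 * x).
suff : f 0 <= f y by rewrite /f mulr0 expR0 mul0r; lra.
have df (x : R) : is_derive x 1 f (1 - expR (2 * x) * (1 - 2 * x)).
  have h2 : is_derive x 1 ( *%R (2 : R)) 2.
    by apply: is_derive_eq; last exact: scaler1.
  pose g : R -> R := expR \o *%R 2.
  have h1 : is_derive x 1 g (2 * expR (2 * x)).
    by apply: is_derive_eq; rewrite mulrC.
  rewrite (_ : f = id * (g + cst 1) - g)//.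
  apply: is_derive_eq; rewrite /GRing.scale/= -[(_ + cst 1) x]/(expR (2 * x) + 1).
  by ring.
apply: (@ger0_derive1_le_cc R f 0 y) => //.
- move=> x _; rewrite derive1E (@derive_val _ _ _ _ _ _ _ (df x)).
  have := expR_ge1Dx (- (2 * x)); rewrite expRN => h.
  have e0 := expR_gt0 (2 * x).
  rewrite subr_ge0 -ler_pdivlMl// mulr1; lra.
- apply: derivable_within_continuous => x _.
  exact: (@ex_derive _ _ _ _ _ _ _ (df x)).
- by rewrite in_itv/= lexx.
- by rewrite in_itv/= lexx andbT.
Qed.

(** With [X : Y] and [X' : Y'] the odds of one event under two distributions,
    the two probabilities are furthest apart when the odds are [e ^ (D / 2)]
    and [e ^ (- D / 2)], where they differ by [tanh (D / 4)]. *)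
Lemma odds_bound (R : realType) (D X Y X' Y' : R) :
  0 <= D -> 0 <= X -> 0 <= Y -> 0 <= X' -> 0 <= Y' ->
  0 < X + Y -> 0 < X' + Y' ->
  X * Y' <= expR D * (X' * Y) ->
  X / (X + Y) - X' / (X' + Y') <= D / 4.
Proof.
move=> D0 X0 Y0 X'0 Y'0 S0 S'0 h.
set x := expR (2 * (D / 4)).
have xE : expR D = x * x by rewrite -expRD; congr expR; field.
have x1 : 1 <= x by rewrite -expR0 ler_expR; lra.
have tn : x - 1 <= D / 4 * (x + 1) by apply: tanh_le_id; lra.
have -> : X / (X + Y) - X' / (X' + Y') =
    (X * Y' - X' * Y) / ((X + Y) * (X' + Y')).
  by field; rewrite !gt_eqF.
rewrite ler_pdivrMr ?mulr_gt0//.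
have B0 : 0 <= X' * Y by rewrite mulr_ge0.
have A0 : 0 <= X * Y' by rewrite mulr_ge0.
have C0 : 0 <= X * X' by rewrite mulr_ge0.
have E0 : 0 <= Y * Y' by rewrite mulr_ge0.
(* The bound [(x - 1) / (x + 1)], which is [tanh (D / 4)], for the difference;
   [x] is the square root of the largest possible ratio of the odds. *)
have key : (X * Y' - X' * Y) * (x + 1) <= (x - 1) * ((X + Y) * (X' + Y')).
  set A := X * Y' in h A0 *; set B := X' * Y in h B0 *.
  have CE : (X * X') * (Y * Y') = A * B by rewrite /A /B; ring.
  have -> : (X + Y) * (X' + Y') = A + B + (X * X' + Y * Y') by rewrite /A /B; ring.
  (* The inequality of the arithmetic and geometric means removes the two
     diagonal products from the denominator. *)
  have sq : 4 * (A * B) <= (X * X' + Y * Y') ^+ 2.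
    by rewrite -CE; have := sqr_ge0 (X * X' - Y * Y'); nra.
  move: (X * X' + Y * Y') (addr_ge0 C0 E0) sq => T T0 sq.
  rewrite xE in h.
  suff : 2 * (A - x * B) <= (x - 1) * T by nra.
  have [le|gt] := lerP A (x * B).
    by apply: (@le_trans _ _ 0); [nra | apply: mulr_ge0 => //; lra].
  rewrite -(@ler_pXn2r _ 2)// ?nnegrE; [|lra|by apply: mulr_ge0 => //; lra].
  rewrite [in leRHS]exprMn.
  apply: (@le_trans _ _ ((x - 1) ^+ 2 * (4 * (A * B)))); last first.
    by rewrite ler_wpM2l ?sqr_ge0.
  have : (A - x * x * B) * (A - B) <= 0.
    have AB : B <= A by nra.
    by rewrite mulr_le0_ge0; lra.
  nra.
have xp : 0 < x + 1 by lra.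
rewrite -(ler_pM2r xp); apply: (le_trans key).
rewrite mulrAC ler_wpM2r//; rewrite mulr_ge0; lra.
Qed.

Definition boltzmann (R : realType) (I : finType) (u : I -> R) (s : I) : R :=
  expR (- u s) / \sum_y expR (- u y).

Lemma boltzmann_ge0 (R : realType) (I : finType) (u : I -> R) s :
  0 <= boltzmann u s.
Proof.
by rewrite divr_ge0 ?expR_ge0// sumr_ge0// => y _; rewrite expR_ge0.
Qed.

Lemma sum_expR_gt0 (R : realType) (I : finType) (u : I -> R) (s : I) :
  0 < \sum_y expR (- u y).
Proof.
by rewrite (bigD1 s)//= ltr_pwDl ?expR_gt0// sumr_ge0.
Qed.

Lemma sum_boltzmann (R : realType) (I : finType) (u : I -> R) (s : I) :
  \sum_y boltzmann u y = 1.
Proof. by rewrite -mulr_suml divff// gt_eqF// (sum_expR_gt0 u s). Qed.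

Lemma boltzmann_event (R : realType) (I : finType) (E : pred I) (u v : I -> R)
    (D : R) : 0 <= D ->
  (forall s s', (u s - v s) - (u s' - v s') <= D) ->
  \sum_(s | E s) boltzmann u s - \sum_(s | E s) boltzmann v s <= D / 4.
Proof.
move=> D0 uv; have [s0 _|I0] := pickP [pred s : I | true]; last first.
  by rewrite !big1 ?subr0 ?divr_ge0// => s; have := I0 s.
pose Z (w : I -> R) (P : pred I) := \sum_(s | P s) expR (- w s).
have Z0 w P : 0 <= Z w P by rewrite sumr_ge0// => s _; rewrite expR_ge0.
have ZE w : \sum_s expR (- w s) = Z w E + Z w (predC E) by rewrite (bigID E).
have ZZ w : 0 < Z w E + Z w (predC E) by rewrite -ZE (sum_expR_gt0 w s0).
rewrite -!mulr_suml !ZE -/(Z u E) -/(Z v E); apply: odds_bound => //.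
rewrite /Z mulr_suml [X in _ * X]mulr_suml mulr_sumr; apply: ler_sum => s _.
rewrite mulr_sumr [X in _ * X]mulr_sumr mulr_sumr; apply: ler_sum => s' _.
by rewrite -!expRD ler_expR; have := uv s' s; lra.
Qed.

(** The difference of the two expectations is at most the oscillation of [f]
    times the largest difference of the two probabilities of an event. The
    constant [1 / 4] is the best possible, and a worse one would not do with
    the threshold [2] of Dobrushin's condition. *)
Lemma boltzmann_lipschitz (R : realType) (I : finType) (u v f : I -> R)
    (D M : R) : 0 <= D -> 0 <= M ->
  (forall s s', (u s - v s) - (u s' - v s') <= D) ->
  (forall s s', f s - f s' <= M) ->
  `|\sum_s (boltzmann u s - boltzmann v s) * f s| <= M * (D / 4).
Proof.
move=> D0 M0 uv fM.
suff main g : (forall s s', g s - g s' <= M) ->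
    \sum_s (boltzmann u s - boltzmann v s) * g s <= M * (D / 4).
  rewrite ler_norml main// andbT lerNl -sumrN.
  under eq_bigr do rewrite -mulrN.
  by apply: main => s s'; have := fM s' s; lra.
move=> gM; have [s0 _|I0] := pickP [pred s : I | true]; last first.
  by rewrite big1 ?mulr_ge0 ?divr_ge0// => s; have := I0 s.
have [m gm] : exists m, forall s, g m <= g s.
  by case: (arg_minP g (erefl : xpredT s0)) => m _ h; exists m => s; apply: h.
(* Both distributions have total mass [1], so [g] may be shifted to have
   minimum [0]. *)
have -> : \sum_s (boltzmann u s - boltzmann v s) * g s =
    \sum_s (boltzmann u s - boltzmann v s) * (g s - g m).
  under [RHS]eq_bigr do rewrite mulrBr.
  by rewrite big_split/= sumrN -mulr_suml sumrB !(sum_boltzmann _ s0) subrr mul0r subr0.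
pose E := [pred s | boltzmann v s <= boltzmann u s].
apply: (@le_trans _ _ (\sum_(s | E s) (boltzmann u s - boltzmann v s) * M)).
  rewrite (bigID E)/= -[leRHS]addr0 lerD//.
    by apply: ler_sum => s /= Es; rewrite ler_wpM2l ?subr_ge0.
  apply: sumr_le0 => s; rewrite -ltNge => Es.
  by rewrite mulr_le0_ge0 ?subr_ge0// subr_le0 ltW.
by rewrite -mulr_suml mulrC ler_wpM2l// sumrB boltzmann_event.
Qed.

(** * Unordered sums of nonnegative terms *)

Section esum_complements.
Local Open Scope ereal_scope.
Variables (R : realType).

Let esumZl_ge0 (T : choiceType) (I : set T) (c : \bar R) (a : T -> \bar R) :
  0 <= c -> (forall i, 0 <= a i) ->
  \esum_(i in I) (c * a i) = c * \esum_(i in I) a i.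
Proof.
move=> c0 a0; apply/eqP; rewrite eq_le; apply/andP; split.
  apply: ge_ereal_sup => _ [X IX <-]; rewrite -ge0_mule_fsumr//.
  by apply: lee_wpmul2l => //; apply: ereal_sup_ubound; exists X.
case: c c0 => [c| |]// c0.
- have [->|c_neq0] := eqVneq c 0%R.
    by rewrite mul0e esum1// => i _; exact: mul0e.
  have cp : (0 < c)%R by rewrite lt_def c_neq0.
  rewrite -lee_pdivlMl//; apply: ge_ereal_sup => _ [X IX <-].
  rewrite lee_pdivlMl// ge0_mule_fsumr//.
  by apply: ereal_sup_ubound; exists X.
- have [->|s_neq0] := eqVneq (\esum_(i in I) a i) 0.
    by rewrite mule0 esum_ge0// => i _; rewrite mule_ge0.
  have s0 : 0 < \esum_(i in I) a i.
    by rewrite lt_def s_neq0 esum_ge0.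
  rewrite gt0_mulye//.
  have [j Ij aj] : exists2 j, I j & 0 < a j.
    apply: contrapT => h; move: s0; rewrite esum1 ?ltxx// => i Ii.
    apply/eqP; rewrite eq_le a0 andbT leNgt; apply/negP => ai; apply: h.
    by exists i.
  apply: esum_ge; exists [set j]; last by rewrite fsbig_set1 gt0_mulye.
  by split; [exact: finite_set1|move=> _ ->].
Qed.

Lemma esumZl (T : choiceType) (I : set T) (c : \bar R) (a : T -> \bar R) :
  0 <= c -> (forall i, I i -> 0 <= a i) ->
  \esum_(i in I) (c * a i) = c * \esum_(i in I) a i.
Proof.
move=> c0 a0; rewrite esum_mkcond [in RHS]esum_mkcond -esumZl_ge0//.
  by apply: eq_esum => i _; case: ifP; rewrite ?mule0.
by move=> i; case: ifPn => // /set_mem/a0.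
Qed.

Lemma sum_const_ereal (T : Type) (s : seq T) (c : \bar R) : 0 <= c ->
  \sum_(i <- s) c = (size s)%:R%:E * c.
Proof.
move=> c0; elim: s => [|x s IHs]; first by rewrite big_nil mul0e.
rewrite big_cons IHs /= -natr1 EFinD ge0_muleDl ?lee_fin//.
by rewrite mul1e addeC.
Qed.

Lemma esum_exchange (T1 T2 : choiceType) (I : set T1) (J : T1 -> set T2)
    (K : set T2) (L : T2 -> set T1) (a : T1 -> T2 -> \bar R) :
  (forall i j, I i /\ J i j <-> K j /\ L j i) -> (forall i j, 0 <= a i j) ->
  \esum_(i in I) \esum_(j in J i) a i j = \esum_(j in K) \esum_(i in L j) a i j.
Proof.
move=> IJKL a0; rewrite !esum_esum//.
rewrite (reindex_esum (K `*`` L) _ (fun x => (x.2, x.1)))//.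
split.
- by move=> [j i] /= /IJKL.
- by move=> [j i] [j' i'] _ _ /= [-> ->].
- by move=> [i j] /= /IJKL h; exists (j, i).
Qed.

Lemma le_esum_subset (T : choiceType) (I J : set T) (a : T -> \bar R) :
  I `<=` J -> (forall i, 0 <= a i) ->
  \esum_(i in I) a i <= \esum_(i in J) a i.
Proof.
move=> IJ a0; apply: ge_ereal_sup => _ [X [fX XI] <-].
by apply: ereal_sup_ubound; exists X => //; split=> // x /XI/IJ.
Qed.

Lemma sum_le_esum (T : choiceType) (I : set T) (a : T -> \bar R) (s : seq T) :
  uniq s -> (forall i, 0 <= a i) -> {in s, forall i, I i} ->
  \sum_(i <- s) a i <= \esum_(i in I) a i.
Proof.
move=> us a0 sI; apply: esum_ge; exists [set` s].
  by split; [exact: finite_seq|move=> i /sI].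
by rewrite fsbig_seq.
Qed.

Lemma esum_seq (T : choiceType) (a : T -> \bar R) (s : seq T) :
  uniq s -> (forall i, 0 <= a i) ->
  \esum_(i in [set` s]) a i = \sum_(i <- s) a i.
Proof.
move=> us a0; rewrite (esum_fset (finite_seq s)); last by move=> i _; exact: a0.
by rewrite -fsbig_seq.
Qed.

End esum_complements.

(** * Couplings of an interaction *)

Lemma le_diam (A : {fset int}) (a b : int) :
  a \in A -> b \in A -> `|a - b| <= diam A.
Proof.
move=> aA bA; rewrite /diam.
have mx c : c \in A -> c <= seq_max 0 A.
  by move=> cA; rewrite /seq_max (le_bigmax_seq _ _ xpredT).
have mn c : c \in A -> seq_min 0 A <= c.
  by move=> cA; rewrite /seq_min (ge_bigmin_seq _ _ xpredT).
by have := mx a aA; have := mx b bA; have := mn a aA; have := mn b bA; lia.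
Qed.

Lemma expR_chord (R : realType) (s x : R) : 0 <= s <= 1 ->
  expR (s * x) <= (1 - s) + s * expR x.
Proof.
move=> /andP[s0 s1].
have e0 := expR_gt0 (s * x).
have h0 : 1 - s * x <= expR (- (s * x)) := expR_ge1Dx _.
have h1 : 1 + (1 - s) * x <= expR ((1 - s) * x) := expR_ge1Dx _.
have -> : expR x = expR (s * x) * expR ((1 - s) * x).
  by rewrite -expRD; congr expR; ring.
have {}h0 : expR (s * x) * (1 - s * x) <= 1.
  by rewrite -ler_pdivlMl// mulr1 -expRN.
have {}h1 := ler_wpM2l (ltW e0) h1.
have := ler_wpM2l s0 h1.
have : 0 <= 1 - s by lra.
move=> s1' h1'; have := ler_wpM2l s1' h0; nra.
Qed.

Section coupling.
Variables (R : realType) (S : {fset R}) (hS : S != fset0).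
Variable (phi : interaction S).
Hypothesis phi_shift : shift_invariant phi.

Definition coupling (i j : int) : \bar R :=
  \esum_(A in [set A : {fset int} | i \in A /\ j \in A]) oscillation phi A.

Lemma oscillation_ge0 (A : {fset int}) : (0 <= oscillation phi A)%E.
Proof.
have [s sS] := fset0Pn _ hS.
have w0 : int -> S by move=> _; exact: [` sS]%fset.
by apply: ereal_sup_ubound; exists (w0, w0) => //=; rewrite subrr normr0.
Qed.

Lemma le_oscillation (A : {fset int}) (w w' : int -> S) :
  (`|phi A w - phi A w'|%:E <= oscillation phi A)%E.
Proof. by apply: ereal_sup_ubound; exists (w, w'). Qed.

Lemma coupling_ge0 (i j : int) : (0 <= coupling i j)%E.
Proof. by apply: esum_ge0 => A _; exact: oscillation_ge0. Qed.

Let translate (i : int) (A : {fset int}) : {fset int} := [fset (a + i)%R | a in A]%fset.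

Let mem_translate i A j : (j \in translate i A) = (j - i \in A).
Proof.
apply/imfsetP/idP => [[a aA ->]|jA]; first by rewrite addrK.
by exists (j - i) => //; rewrite subrK.
Qed.

Let oscillation_translate i A : A != fset0 ->
  (oscillation phi (translate i A) <= oscillation phi A)%E.
Proof.
move=> A0; apply: ge_ereal_sup => _ [[w w'] _ <-] /=.
by rewrite !phi_shift//; exact: le_oscillation.
Qed.

(** Exchanging the two sums turns a weighted row of couplings into a sum over
    the sets at the origin, where each site of [A] other than the origin
    contributes at most the weight of the diameter. *)
Lemma weighted_coupling_le (th : R) (i : int) : 0 <= th ->
  (\esum_(j in [set j | j != i]) ((expR (th * `|i - j|%:~R))%:E * coupling i j)
   <= \esum_(A in [set A : {fset int} | (0 : int) \in A])
         ((expR (th * (diam A)%:~R) * (#|` A|%:R - 1))%:E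
            * oscillation phi A))%E.
Proof.
move=> th0.
rewrite (@eq_esum _ _ _ _ (fun j =>
    \esum_(A in [set A : {fset int} | i \in A /\ j \in A])
      ((expR (th * `|i - j|%:~R))%:E * oscillation phi A)%E)); last first.
  move=> j _; rewrite esumZl ?lee_fin ?expR_ge0// => A _.
  exact: oscillation_ge0.
rewrite (@esum_exchange _ _ _ _ _ [set A : {fset int} | i \in A]
    (fun A => [set j | j != i /\ j \in A])); last 2 first.
- by move=> j A; rewrite /mkset; tauto.
- by move=> j A; apply: mule_ge0; [rewrite lee_fin expR_ge0|exact: oscillation_ge0].
rewrite (reindex_esum [set A : {fset int} | 0 \in A] _ (translate i)); last first.
  split.
  - by move=> A /= ?; rewrite mem_translate subrr.
  - move=> A B _ _ AB; apply/fsetP => j; have /fsetP/(_ (j + i)) := AB.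
    by rewrite !mem_translate addrK.
  - move=> A /= iA; exists (translate (- i) A) => /=.
      by rewrite mem_translate opprK add0r.
    by apply/fsetP => j; rewrite !mem_translate opprK subrK.
apply: le_esum => A /= A0.
have An0 : A != fset0 by apply/fset0Pn; exists 0.
pose s := [seq j <- translate i A | j != i].
rewrite (_ : [set j | _] = [set` s]); last first.
  by apply/seteqP; split=> j /=; rewrite mem_filter => /andP.
rewrite esum_seq ?filter_uniq ?fset_uniq//; last first.
  by move=> j; rewrite mule_ge0 ?lee_fin ?expR_ge0 ?oscillation_ge0.
have ss : (size s)%:R = #|` A|%:R - 1 :> R.
  have := count_predC (pred1 i) (translate i A).
  rewrite count_uniq_mem ?fset_uniq// mem_translate subrr A0 -size_filter -/s.
  by rewrite card_imfset/=; [move=> <-; rewrite natrD addrC addKr|exact: addIr].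
apply: (@le_trans _ _
    (\sum_(j <- s) (expR (th * (diam A)%:~R))%:E * oscillation phi A)%E).
  rewrite big_seq [leRHS]big_seq; apply: lee_sum => j.
  rewrite mem_filter mem_translate => /andP[_ jA].
  apply: lee_pmul; rewrite ?lee_fin ?expR_ge0 ?oscillation_ge0 ?oscillation_translate//.
  rewrite ler_expR ler_wpM2l// ler_int distrC.
  by have := le_diam jA A0; rewrite subr0.
rewrite sum_const_ereal ?mule_ge0 ?lee_fin ?expR_ge0 ?oscillation_ge0//.
by rewrite -ss [_ * (size s)%:R]mulrC EFinM muleA.
Qed.

(** Along the chord of the exponential, the weighted sum at the rate [s * t] is
    at most [1 - s] times Dobrushin's sum plus [s] times the finite
    exponential sum, hence still below [2] when [s] is small. *)
Lemma weighted_coupling_lt (t : R) : 0 < t ->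
  (\esum_(A in [set A : {fset int} | (0 : int) \in A])
     ((#|` A|%:R - 1)%:E * oscillation phi A) < 2%:E)%E ->
  (\esum_(A in [set A : {fset int} | (0 : int) \in A])
     ((expR (t * (diam A)%:~R) * (#|` A|%:R - 1))%:E * oscillation phi A)
   < +oo)%E ->
  exists th al : R, [/\ 0 < th, 0 <= al < 1 & forall i : int,
    (\esum_(j in [set j | j != i])
       ((expR (th * `|i - j|%:~R))%:E * coupling i j) <= (2 * al)%:E)%E].
Proof.
move=> t0.
set D := esum _ _ => D2; set E := esum _ _ => Eoo.
have card0 (A : {fset int}) : 0 \in A -> 0 <= #|` A|%:R - 1 :> R.
  by move=> A0; rewrite subr_ge0 ler1n cardfs_gt0; apply/fset0Pn; exists 0.
have D0 : (0 <= D)%E.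
  by apply: esum_ge0 => A A0; rewrite mule_ge0 ?lee_fin ?card0 ?oscillation_ge0.
have E0 : (0 <= E)%E.
  apply: esum_ge0 => A A0.
  by rewrite mule_ge0 ?lee_fin ?mulr_ge0 ?expR_ge0 ?card0 ?oscillation_ge0.
have Dfin : D \is a fin_num by rewrite ge0_fin_numE// (lt_trans D2)// ltry.
have Efin : E \is a fin_num by rewrite ge0_fin_numE.
pose de := fine D; pose e := fine E.
have DE : D = de%:E by rewrite fineK.
have EE : E = e%:E by rewrite fineK.
have de2 : de < 2 by rewrite -lte_fin -DE.
have de0 : 0 <= de by rewrite -lee_fin -DE.
have e0 : 0 <= e by rewrite -lee_fin -EE.
(* [s] makes the chord value [(1 - s) D + s E] smaller than [2]. *)
pose s := (2 - de) / (2 * (1 + e)).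
have s0 : 0 < s by rewrite divr_gt0//; lra.
have s1 : s <= 1 by rewrite ler_pdivrMr; lra.
have se : s * e < 2 - de.
  rewrite /s mulrAC ltr_pdivrMr; last lra.
  have : 0 < 2 - de by lra.
  nra.
have sde : 0 <= s * de by rewrite mulr_ge0// ltW.
move: s s0 s1 se sde => s s0 s1 se sde.
exists (s * t), (((1 - s) * de + s * e) / 2); split.
- by rewrite mulr_gt0.
- apply/andP; split; last by lra.
  by rewrite divr_ge0// addr_ge0// mulr_ge0//; lra.
- move=> i; rewrite mulrCA divff// mulr1.
  apply: (le_trans (weighted_coupling_le i _)); first by rewrite mulr_ge0 ?ltW.
  rewrite EFinD !EFinM -DE -EE -!esumZl ?lee_fin ?subr_ge0 ?(ltW s0)//; last 2 first.
  - by move=> A A0; rewrite mule_ge0 ?lee_fin ?mulr_ge0 ?expR_ge0 ?card0 ?oscillation_ge0.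
  - by move=> A A0; rewrite mule_ge0 ?lee_fin ?card0 ?oscillation_ge0.
  rewrite -esumD; last 2 first.
  - move=> A A0; apply: mule_ge0; first by rewrite lee_fin subr_ge0.
    by rewrite mule_ge0 ?lee_fin ?card0 ?oscillation_ge0.
  - move=> A A0; apply: mule_ge0; first by rewrite lee_fin ltW.
    by rewrite mule_ge0 ?lee_fin ?mulr_ge0 ?expR_ge0 ?card0 ?oscillation_ge0.
  apply: le_esum => A A0; rewrite !muleA -ge0_muleDl; last 2 first.
  - by rewrite lee_fin mulr_ge0 ?card0 ?subr_ge0.
  - by rewrite lee_fin !mulr_ge0 ?expR_ge0 ?card0 ?(ltW s0).
  apply: lee_wpmul2r; rewrite ?oscillation_ge0//.
  rewrite -!EFinM -EFinD lee_fin mulrA -mulrDl.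
  by rewrite ler_wpM2r ?card0// -mulrA expR_chord// (ltW s0).
Qed.

End coupling.

(** * Resampling the spin at one site *)

Section splice.
Variables (R : realType) (S : {fset R}) (L : {fset int}).
Implicit Types (z : {ffun L -> S}) (w : int -> S).

Lemma splice_notin z w (j : int) : j \notin L -> splice z w j = w j.
Proof. by move=> jL; rewrite /splice insubN. Qed.

Lemma splice_in z w w' (j : int) : j \in L -> splice z w j = splice z w' j.
Proof. by move=> jL; rewrite /splice insubT. Qed.

Lemma splice_self z w : (forall l : L, w (val l) = z l) -> splice z w = w.
Proof.
move=> wz; apply/funext => j; rewrite /splice.
by case: insubP => // l _ <-; rewrite wz.
Qed.

End splice.

Section gibbs_density.
Variables (R : realType) (S : {fset R}) (hS : S != fset0).
Variables (phi : interaction S) (L : {fset int}).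

Lemma gibbs_density_ge0 (z : {ffun L -> S}) w :
  0 <= gibbs_density phi z w.
Proof. exact: boltzmann_ge0. Qed.

Lemma sum_gibbs_density w :
  \sum_(z : {ffun L -> S}) gibbs_density phi z w = 1.
Proof.
have [s sS] := fset0Pn _ hS.
exact: (sum_boltzmann (fun y => hamiltonian phi L (splice y w))
  [ffun=> [` sS]%fset]).
Qed.

Lemma gibbs_density_le1 (z : {ffun L -> S}) w :
  gibbs_density phi z w <= 1.
Proof.
rewrite -(sum_gibbs_density w) (bigD1 z)//= lerDl sumr_ge0// => y _.
exact: gibbs_density_ge0.
Qed.

End gibbs_density.

(** Replaces an extended bound by a real one, so that the estimate for finite
    Gibbs distributions applies even if the bound is infinite. *)
Lemma le_EFin_finite (R : realType) (I : finType) (f : I -> R) (B : \bar R) :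
  (0 <= B)%E -> (forall x, (f x)%:E <= B)%E ->
  exists M : R, [/\ 0 <= M, (M%:E <= B)%E & forall x, f x <= M].
Proof.
case: B => [r| |]// r0 fB.
- by exists r; split=> // x; have := fB x.
- exists (\sum_x `|f x|); rewrite leey sumr_ge0//; split=> // x.
  by rewrite (bigD1 x)//= (le_trans (ler_norm _))// lerDl sumr_ge0.
Qed.

Section heat_bath.
Variables (R : realType) (S : {fset R}) (hS : S != fset0).
Variable (phi : interaction S).
Hypothesis phi_potential : is_potential phi.
Implicit Types (w : int -> S) (h : (int -> S) -> R) (a : int -> \bar R).

Definition heat_bath (i : int) h w : R :=
  \sum_(z : {ffun [fset i]%fset -> S}) gibbs_density phi z w * h (splice z w).

(** Changes at infinitely many sites are included: for a summable [a] this says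
    both that changing the spin at [j] changes [h] by at most [a j] and that [h]
    is quasilocal. *)
Definition site_lipschitz h a : Prop := forall w w',
  (`|h w - h w'|%:E <= \esum_(j in [set j | w j != w' j]) a j)%E.

(** In Dobrushin's theory, [coupling phi i j / 2] is the bound for the influence
    of the spin at [j] on the conditional distribution of the spin at [i]. *)
Definition heat_bath_bound (i : int) a (j : int) : \bar R :=
  if j == i then 0%E else (a j + coupling phi i j * (2^-1%:E * a i))%E.

(** The cross difference vanishes unless [A] contains a site other than [i] at
    which [w] and [w'] differ. *)
Lemma cross_energy_le (i : int) (z z' : {ffun [fset i]%fset -> S}) w w'
    (A : {fset int}) : i \in A ->
  ((phi A (splice z w) - phi A (splice z w')
     - (phi A (splice z' w) - phi A (splice z' w')))%:E <=
   \esum_(j in [set j | (j != i /\ w j != w' j) /\ j \in A])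
     (2%:E * oscillation phi A))%E.
Proof.
move=> iA; have A0 : A != fset0 by apply/fset0Pn; exists i.
have o0 := oscillation_ge0 hS phi A.
have [[j [[ji wj] jA]]|none] :=
    pselect (exists j, (j != i /\ w j != w' j) /\ j \in A).
  apply: (@le_trans _ _ (2%:E * oscillation phi A)%E); last first.
    rewrite -[leLHS](@esum_set1 R _ j (fun=> 2%:E * oscillation phi A)%E).
      by apply: le_esum_subset => [_ ->//|_]; rewrite mule_ge0.
    by rewrite mule_ge0.
  rewrite (_ : 2%:E = 1%:E + 1%:E)%E ?ge0_muleDl ?mul1e//.
  apply: (@le_trans _ _ (`|phi A (splice z w) - phi A (splice z w')|%:E +
      `|phi A (splice z' w) - phi A (splice z' w')|%:E)%E).
    by rewrite -EFinD lee_fin (le_trans (ler_norm _))// ler_normB.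
  by apply: leeD; exact: le_oscillation.
have eqA (y : {ffun [fset i]%fset -> S}) : phi A (splice y w) = phi A (splice y w').
  apply: phi_potential.1 => // j jA.
  have [->|ji] := eqVneq j i; first by apply: splice_in; rewrite inE.
  rewrite !splice_notin ?inE//; apply/eqP/negPn/negP => wj.
  by apply: none; exists j.
by rewrite !eqA !subrr esum_ge0// => j _; rewrite mule_ge0.
Qed.

(** The energies need not converge absolutely, but the cross
    differences of their partial sums are dominated by the couplings, and this
    passes to the limit. *)
Lemma hamiltonian_cross_le (i : int) (z z' : {ffun [fset i]%fset -> S}) w w' :
  ((hamiltonian phi [fset i]%fset (splice z w)
     - hamiltonian phi [fset i]%fset (splice z w')
     - (hamiltonian phi [fset i]%fset (splice z' w)
     - hamiltonian phi [fset i]%fset (splice z' w')))%:E <=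
   2%:E * \esum_(j in [set j | j != i /\ w j != w' j]) coupling phi i j)%E.
Proof.
set B := (_ * _)%E.
have B0 : (0 <= B)%E.
  by rewrite mule_ge0// esum_ge0// => j _; exact: coupling_ge0.
pose part (y : {ffun [fset i]%fset -> S}) v :=
  hamiltonian_part phi [fset i]%fset (splice y v).
have partB D :
    ((part z w D - part z w' D - (part z' w D - part z' w' D))%:E <= B)%E.
  pose s := [seq A <- fpowerset D | ~~ [disjoint A & [fset i]]%fset].
  have sP A : A \in s -> i \in A.
    rewrite mem_filter => /andP[/fset0Pn[j]]; rewrite !inE => /andP[jA /eqP <-].
    by [].
  rewrite /part /hamiltonian_part -!sumrB -big_filter -/s -sumEFin.
  apply: (@le_trans _ _ (\sum_(A <- s)
      \esum_(j in [set j | (j != i /\ w j != w' j) /\ j \in A])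
       (2%:E * oscillation phi A))%E).
    rewrite big_seq [leRHS]big_seq; apply: lee_sum => A /sP.
    exact: cross_energy_le.
  have osc0 A : (0 <= 2%:E * oscillation phi A)%E.
    by rewrite mule_ge0// oscillation_ge0.
  apply: (@le_trans _ _ (\esum_(A in [set A : {fset int} | i \in A])
      \esum_(j in [set j | (j != i /\ w j != w' j) /\ j \in A])
       (2%:E * oscillation phi A))%E).
    apply: sum_le_esum => //; first by rewrite filter_uniq ?fset_uniq.
    by move=> A; rewrite esum_ge0.
  rewrite (@esum_exchange _ _ _ _ _ [set j | j != i /\ w j != w' j]
    (fun j => [set A : {fset int} | i \in A /\ j \in A])) //; last first.
    by move=> A j /=; tauto.
  rewrite /B -esumZl//; last by move=> j _; exact: coupling_ge0.
  apply: le_esum => j _; rewrite -esumZl// => A _; exact: oscillation_ge0.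
have [Boo|Bfin] := eqVneq B +oo%E; first by rewrite Boo leey.
have /fineK BE : B \is a fin_num by rewrite ge0_fin_numE// lt_neqAle Bfin leey.
have partB' D :
    part z w D - part z w' D - (part z' w D - part z' w' D) <= fine B.
  by rewrite -lee_fin BE.
have pcvg y v : part y v @ totally --> lim (part y v @ totally).
  exact: phi_potential.2.
rewrite -BE lee_fin /hamiltonian.
have FT : ProperFilter (@totally int) := totally_filter.
have cv := cvgB (cvgB (pcvg z w) (pcvg z w')) (cvgB (pcvg z' w) (pcvg z' w')).
have {}cv := cv FT FT FT.
by apply: (cvgr_to_le cv); apply: nearW.
Qed.

(** Two effects add up: [h] is evaluated at configurations that agree at [i] but
    differ elsewhere, and the new spin has two different distributions. The
    exponents of the latter differ by a function with oscillation at most twice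
    the sum of the couplings, and [boltzmann_lipschitz] takes a quarter of it. *)
Lemma heat_bath_lipschitz (i : int) h a : (forall j, 0 <= a j)%E ->
  site_lipschitz h a -> site_lipschitz (heat_bath i h) (heat_bath_bound i a).
Proof.
move=> a0 ha w w'.
pose X := {ffun [fset i]%fset -> S}.
pose J := [set j | j != i /\ w j != w' j].
pose H w y := hamiltonian phi [fset i]%fset (splice (y : X) w).
have c0 j : (0 <= coupling phi i j)%E by exact: coupling_ge0.
have rhoE v (z : X) : gibbs_density phi z v = boltzmann (H v) z by [].
have -> : heat_bath i h w - heat_bath i h w' =
    \sum_(z : X) gibbs_density phi z w * (h (splice z w) - h (splice z w')) +
    \sum_(z : X) (boltzmann (H w) z - boltzmann (H w') z) * h (splice z w').
  rewrite -sumrB -big_split/=; apply: eq_bigr => z _.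
  by rewrite !rhoE; ring.
have d1 (z : X) : (`|h (splice z w) - h (splice z w')|%:E <= \esum_(j in J) a j)%E.
  apply: (le_trans (ha _ _)); apply: le_esum_subset => // j /=.
  have [->|ji] := eqVneq j i.
    by rewrite (splice_in z w w') ?inE// eqxx.
  by rewrite !splice_notin ?inE.
have d2 (p : X * X) : ((h (splice p.1 w') - h (splice p.2 w'))%:E <= a i)%E.
  apply: (@le_trans _ _ (`|h (splice p.1 w') - h (splice p.2 w')|%:E)).
    by rewrite lee_fin ler_norm.
  apply: (le_trans (ha _ _)); rewrite -[leRHS]esum_set1//.
  apply: le_esum_subset => // j /=; apply: contraNP => ji.
  by rewrite !splice_notin ?inE//; exact/eqP.
have d3 (p : X * X) : ((H w p.1 - H w' p.1 - (H w p.2 - H w' p.2))%:E <=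
    2%:E * \esum_(j in J) coupling phi i j)%E.
  exact: hamiltonian_cross_le.
have [M1 [M10 M1B M1h]] := le_EFin_finite (esum_ge0 (fun j _ => a0 j)) d1.
have [M2 [M20 M2B M2h]] := le_EFin_finite (a0 i) d2.
have B0 : (0 <= 2%:E * \esum_(j in J) coupling phi i j)%E.
  by rewrite mule_ge0// esum_ge0.
have [D [D0 DB Dh]] := le_EFin_finite B0 d3.
apply: (@le_trans _ _ (M1%:E + (D / 4)%:E * M2%:E)%E).
  rewrite -EFinM -EFinD lee_fin (le_trans (ler_normD _ _))// lerD//.
    rewrite (le_trans (ler_norm_sum _ _ _))// -[leRHS]mul1r.
    rewrite -(sum_gibbs_density hS phi [fset i]%fset w) mulr_suml.
    apply: ler_sum => z _; rewrite normrM ger0_norm ?gibbs_density_ge0//.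
    by rewrite ler_wpM2l// gibbs_density_ge0.
  rewrite mulrC; apply: boltzmann_lipschitz => // z z'; first exact: (Dh (z, z')).
  exact: (M2h (z, z')).
have ci0 j : (0 <= coupling phi i j * (2^-1%:E * a i))%E.
  by rewrite !mule_ge0.
apply: (@le_trans _ _ (\esum_(j in J) (a j + coupling phi i j * (2^-1%:E * a i)))%E).
  rewrite esumD//; apply: leeD => //.
  rewrite (eq_esum (b := fun j => (2^-1%:E * a i) * coupling phi i j)%E); last first.
    by move=> j _; rewrite muleC.
  rewrite esumZl ?mule_ge0// muleAC; apply: lee_pmul => //.
    by rewrite lee_fin divr_ge0.
  have -> : (2^-1%:E = (4^-1)%:E * 2%:E :> \bar R)%E.
    by rewrite -EFinM; congr _%:E; field.
  rewrite mulrC EFinM -muleA; exact: lee_wpmul2l.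
apply: (@le_trans _ _ (\esum_(j in J) heat_bath_bound i a j)).
  by apply: le_esum => j /= [/negPf ji _]; rewrite /heat_bath_bound ji.
apply: le_esum_subset => [j []//|j]; rewrite /heat_bath_bound.
by case: ifP => // _; rewrite adde_ge0.
Qed.

End heat_bath.

(** * Expectations of bounded observables *)

Section bounded_measurable.
Context d (T : measurableType d) (R : realType) (P : probability T R).
Implicit Types f g u : T -> R.

Definition bounded_measurable f : Prop :=
  measurable_fun setT f /\ exists M : R, forall x, `|f x| <= M.

Lemma bounded_measurableP f (M : R) :
  measurable_fun setT f -> (forall x, `|f x| <= M) -> bounded_measurable f.
Proof. by move=> mf fM; split=> //; exists M. Qed.

Lemma bounded_measurable_cst (r : R) : bounded_measurable (fun=> r).
Proof. by split; [exact: measurable_cst|exists `|r|]. Qed.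

Lemma bounded_measurableD f g : bounded_measurable f -> bounded_measurable g ->
  bounded_measurable (fun x => f x + g x).
Proof.
move=> [mf [M fM]] [mg [N gN]]; split; first exact: measurable_funD.
by exists (M + N) => x; rewrite (le_trans (ler_normD _ _))// lerD.
Qed.

Lemma bounded_measurableM f g : bounded_measurable f -> bounded_measurable g ->
  bounded_measurable (fun x => f x * g x).
Proof.
move=> [mf [M fM]] [mg [N gN]]; split; first exact: measurable_funM.
by exists (M * N) => x; rewrite normrM ler_pM.
Qed.

Lemma bounded_measurableB f g : bounded_measurable f -> bounded_measurable g ->
  bounded_measurable (fun x => f x - g x).
Proof.
move=> bf bg; rewrite (_ : (fun _ => _) = (fun x => f x + (-1) * g x)).
  by apply: bounded_measurableD => //; apply: bounded_measurableM => //;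
    exact: bounded_measurable_cst.
by apply/funext => x; rewrite mulN1r.
Qed.

Lemma bounded_measurable_sum (I : Type) (s : seq I) (F : I -> T -> R) :
  (forall i, bounded_measurable (F i)) ->
  bounded_measurable (fun x => \sum_(i <- s) F i x).
Proof.
move=> bF; elim: s => [|i s IHs].
  by under eq_fun do rewrite big_nil; exact: bounded_measurable_cst.
by under eq_fun do rewrite big_cons; exact: bounded_measurableD.
Qed.

Lemma bounded_measurable_prod (I : Type) (s : seq I) (F : I -> T -> R) :
  (forall i, bounded_measurable (F i)) ->
  bounded_measurable (fun x => \prod_(i <- s) F i x).
Proof.
move=> bF; elim: s => [|i s IHs].
  by under eq_fun do rewrite big_nil; exact: bounded_measurable_cst.
by under eq_fun do rewrite big_cons; exact: bounded_measurableM.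
Qed.

Lemma bounded_measurable_indic (B : set T) :
  measurable B -> bounded_measurable (\1_B).
Proof.
move=> mB; apply: (@bounded_measurableP _ 1); first exact: measurable_indic.
by move=> x; rewrite indicE; case: (_ \in _); rewrite ?normr1 ?normr0.
Qed.

Lemma bounded_measurable_integrable f :
  bounded_measurable f -> P.-integrable setT (EFin \o f).
Proof.
move=> [mf [M fM]]; apply: measurable_bounded_integrable => //.
  by rewrite (le_lt_trans (probability_le1 _ _))// ltry.
exists M; split; first exact: num_real.
by move=> x Mx y _; exact: le_trans (fM y) (ltW Mx).
Qed.

Lemma RintegralD_bounded f g : bounded_measurable f -> bounded_measurable g ->
  \int[P]_x (f x + g x) = \int[P]_x f x + \int[P]_x g x.
Proof. by move=> *; apply: RintegralD => //; exact: bounded_measurable_integrable. Qed.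

Lemma RintegralB_bounded f g : bounded_measurable f -> bounded_measurable g ->
  \int[P]_x (f x - g x) = \int[P]_x f x - \int[P]_x g x.
Proof. by move=> *; apply: RintegralB => //; exact: bounded_measurable_integrable. Qed.

Lemma RintegralZ_bounded (r : R) f : bounded_measurable f ->
  \int[P]_x (r * f x) = r * \int[P]_x f x.
Proof. by move=> *; apply: RintegralZl => //; exact: bounded_measurable_integrable. Qed.

Lemma Rintegral_sum_bounded (I : Type) (s : seq I) (F : I -> T -> R) :
  (forall i, bounded_measurable (F i)) ->
  \int[P]_x (\sum_(i <- s) F i x) = \sum_(i <- s) \int[P]_x F i x.
Proof.
move=> bF; elim: s => [|i s IHs].
  rewrite big_nil (_ : (fun _ => _) = fun=> 0).
    by rewrite Rintegral_cst// mul0r.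
  by apply/funext => x; rewrite big_nil.
rewrite big_cons -IHs -RintegralD_bounded//; last exact: bounded_measurable_sum.
by congr Rintegral; apply/funext => x; rewrite big_cons.
Qed.

Lemma normr_Rintegral_le f (M : R) : measurable_fun setT f ->
  (forall x, `|f x| <= M) -> `|\int[P]_x f x| <= M.
Proof.
move=> mf fM; have bf := bounded_measurableP mf fM.
rewrite (le_trans (le_normr_Rintegral _ _))//.
  exact: bounded_measurable_integrable.
have -> : M = \int[P]_x M.
  by rewrite Rintegral_cst// [X in fine X](probability_setT P) mulr1.
apply: le_Rintegral => //; apply: bounded_measurable_integrable.
- apply: (@bounded_measurableP _ M); first exact: measurableT_comp.
  by move=> x; rewrite normr_id.
- exact: bounded_measurable_cst.
Qed.

(** It suffices to test [u] against indicators because [g] is, up to any [e > 0],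
    a combination of the indicators of the sets on which the integer part of
    [g / e] is constant. *)
Lemma Rintegral_orthogonal (G : set_system T) u g (M : R) :
  G `<=` measurable ->
  measurable_fun setT u -> (forall x, `|u x| <= 1) ->
  (forall B, G B -> \int[P]_x (u x * \1_B x) = 0) ->
  (forall Y : set R, measurable Y -> G (g @^-1` Y)) -> (forall x, `|g x| <= M) ->
  \int[P]_x (u x * g x) = 0.
Proof.
move=> Gm mu u1 u0 gG gM.
have mg : measurable_fun setT g by move=> _ Y mY; rewrite setTI; exact/Gm/gG.
have bu := bounded_measurableP mu u1; have bg := bounded_measurableP mg gM.
apply/eqP; rewrite -normr_le0; apply/ler_addgt0Pr => e e0; rewrite add0r.
pose N := (Num.trunc (M / e)).+1.
pose lev (m : 'I_(N + N)) : R := e * (m%:R - N%:R).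
pose B m := g @^-1` `[lev m, lev m + e[.
have GB m : G (B m) by exact: gG.
pose ge x := \sum_(m < N + N) lev m * \1_(B m) x.
have bB m : bounded_measurable (\1_(B m)).
  by apply: bounded_measurable_indic; exact: Gm.
have bge : bounded_measurable ge.
  apply: bounded_measurable_sum => m; apply: bounded_measurableM => //.
  exact: bounded_measurable_cst.
have gge x : `|g x - ge x| <= e.
  pose y := g x / e + N%:R.
  have yN : `|g x / e| < N%:R.
    rewrite normrM normfV (gtr0_norm e0) (@le_lt_trans _ _ (M / e))//.
      by rewrite ler_pM2r ?invr_gt0.
    by rewrite truncnS_gt.
  have [yl yr] : - N%:R < g x / e /\ g x / e < N%:R by apply/andP; rewrite -ltr_norml.
  have y0 : 0 <= y by rewrite /y; lra.
  have /andP[ty yt] := truncn_itv y0.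
  have tN : (Num.trunc y < N + N)%N.
    by rewrite -(ltr_nat R) natrD (le_lt_trans ty)// /y; lra.
  have gE : g x = e * (y - N%:R) by rewrite /y addrK mulrC divfK// gt_eqF.
  have BE m : (x \in B m) = (m == Ordinal tN).
    have -> : (x \in B m) = (lev m <= g x < lev m + e).
      by apply/idP/idP => [/set_mem|h]; [|apply: mem_set]; rewrite /B/= in_itv.
    rewrite gE /lev -[X in _ < _ + X]mulr1 -mulrDr.
    rewrite ler_pM2l// ltr_pM2l// lerD2r.
    rewrite [_ - _ + 1]addrAC ltrD2r natr1 -[RHS]val_eqE/= eq_sym -truncn_eq//.
  have -> : ge x = lev (Ordinal tN).
    rewrite /ge (bigD1 (Ordinal tN))//= big1 ?addr0 => [|m mt].
      by rewrite indicE BE eqxx mulr1.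
    by rewrite indicE BE (negPf mt) mulr0.
  rewrite gE /lev/= -mulrBr normrM gtr0_norm// -[leRHS]mulr1 ler_wpM2l ?(ltW e0)//.
  move: yt; rewrite -natr1 => yt.
  by rewrite ler_norml; apply/andP; split; lra.
have uge : \int[P]_x (u x * ge x) = 0.
  rewrite (_ : (fun _ => _) =
      (fun x => \sum_(m < N + N) lev m * (u x * \1_(B m) x))); last first.
    by apply/funext => x; rewrite mulr_sumr; apply: eq_bigr => m _; rewrite mulrCA.
  rewrite Rintegral_sum_bounded => [|m]; last first.
    apply: bounded_measurableM; first exact: bounded_measurable_cst.
    exact: bounded_measurableM.
  rewrite big1// => m _; rewrite RintegralZ_bounded ?u0 ?mulr0//.
  exact: bounded_measurableM.
rewrite -[X in `|X|]subr0 -uge -RintegralB_bounded; [|exact: bounded_measurableM..].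
apply: normr_Rintegral_le.
  by have [] := bounded_measurableB (bounded_measurableM bu bg) (bounded_measurableM bu bge).
by move=> x; rewrite -mulrBr normrM -[e]mul1r ler_pM.
Qed.

End bounded_measurable.

(** * Invariance of Gibbs measures under resampling *)

Section outside.
Variables (R : realType) (S : {fset R}) (hS : S != fset0) (L : {fset int}).
Implicit Types B : set (config hS).

Definition outside : set_system (config hS) :=
  <<s coord_events S [set i | i \notin L] >>.

Lemma outside_measurable : outside `<=` measurable.
Proof.
apply: sub_sigma_algebra2 => _ [i _ [s _ <-]].
by exists i => //; exists s.
Qed.

Lemma measurable_coord (i : int) (s : S) :
  measurable [set w : config hS | w i = s].
Proof. by apply: sub_sigma_algebra; exists i => //; exists s. Qed.

Lemma measurable_cylinder (z : {ffun L -> S}) :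
  measurable [set w : config hS | forall l : L, w (val l) = z l].
Proof.
rewrite (_ : [set w | _] =
    \big[setI/setT]_(l : L) [set w : config hS | w (val l) = z l]).
  by apply: bigsetI_measurable => l _; exact: measurable_coord.
rewrite -bigcap_seq; apply/seteqP; split=> [w wz l _|w wz l]; first exact: wz.
by apply: wz => /=; rewrite mem_index_enum.
Qed.

(** Splicing overwrites the spins in [L], so the preimage of an event only looks
    at the spins outside [L]. *)
Lemma outside_splice (z : {ffun L -> S}) B :
  measurable B -> outside ((fun w => splice z w : config hS) @^-1` B).
Proof.
pose F := [set B | outside ((fun w => splice z w : config hS) @^-1` B)].
suff : measurable `<=` F by apply.
have sout : sigma_algebra setT outside by exact: smallest_sigma_algebra.
apply: smallest_sub.
  split.
  - by rewrite /F/= preimage_set0; case: sout.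
  - move=> A FA; rewrite /F/= setTD preimage_setC -setTD.
    by case: sout => _ + _; apply.
  - move=> A FA; rewrite /F/= preimage_bigcup.
    by case: sout => _ _; apply.
move=> _ [i _ [s _ <-]]; rewrite /F/=.
have [iL|iL] := boolP (i \in L).
  have [[w0 w0s]|none] := pselect (exists w0, splice z w0 i = s).
    rewrite (_ : _ @^-1` _ = setT `\` set0); first by case: sout => o0 + _; apply.
    rewrite setD0; apply/seteqP; split=> // w _ /=.
    by rewrite (splice_in z w w0).
  rewrite (_ : _ @^-1` _ = set0); first by case: sout.
  by rewrite -subset0 => w ws; apply: none; exists w.
rewrite (_ : _ @^-1` _ = [set w : config hS | w i = s]).
  by apply: sub_sigma_algebra; exists i => //; exists s.
by apply/seteqP; split=> w /=; rewrite splice_notin.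
Qed.

Lemma outside_preimage (g : config hS -> R) :
  measurable_fun setT g ->
  (forall w w', (forall j, j \notin L -> w j = w' j) -> g w = g w') ->
  forall Y : set R, measurable Y -> outside (g @^-1` Y).
Proof.
move=> mg gL Y mY.
have [s sS] := fset0Pn _ hS.
pose z : {ffun L -> S} := [ffun=> [` sS]%fset].
rewrite (_ : g @^-1` Y = (fun w => splice z w : config hS) @^-1` (g @^-1` Y)).
  by apply: outside_splice; rewrite -[X in measurable X]setTI; exact: mg.
apply/seteqP; split=> w /=; rewrite (gL (splice z w) w)// => j jL;
  by rewrite splice_notin.
Qed.

End outside.
Arguments outside [R S] hS L.

Section heat_bath_invariance.
Variables (R : realType) (S : {fset R}) (hS : S != fset0).
Variables (phi : interaction S) (mu : probability (config hS) R).
Hypothesis mu_gibbs : is_gibbs phi mu.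
Local Notation bounded_measurable := (@bounded_measurable _ (config hS) R).

Lemma bounded_measurable_density (L : {fset int}) (z : {ffun L -> S}) :
  bounded_measurable (gibbs_density phi z).
Proof.
apply: (@bounded_measurableP _ _ _ _ 1) => [|w].
  move=> _ Y mY; rewrite setTI; apply: (@outside_measurable _ _ hS L).
  exact: (mu_gibbs z).1.
by rewrite ger0_norm ?gibbs_density_ge0 ?gibbs_density_le1.
Qed.

Lemma bounded_measurable_splice (L : {fset int}) (z : {ffun L -> S})
    (h : config hS -> R) :
  bounded_measurable h -> bounded_measurable (fun w => h (splice z w)).
Proof.
move=> [mh [M hM]]; split; last by exists M => w; exact: hM.
move=> _ Y mY; rewrite setTI; apply: (@outside_measurable _ _ hS L).
apply: (outside_splice z (B := h @^-1` Y)).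
by rewrite -[X in measurable X]setTI; exact: mh.
Qed.

Lemma bounded_measurable_heat_bath (i : int) (h : config hS -> R) :
  bounded_measurable h -> bounded_measurable (heat_bath phi i h).
Proof.
move=> bh; apply: bounded_measurable_sum => z; apply: bounded_measurableM.
  exact: bounded_measurable_density.
exact: bounded_measurable_splice.
Qed.

(** By the Gibbs property [gibbs_density] is the conditional distribution of the
    spin at [i] given the others, so [heat_bath phi i h] is the conditional
    expectation of [h], and [g] is a function of what is conditioned on. *)
Lemma heat_bath_invariance (i : int) (h g : config hS -> R) :
  bounded_measurable h -> bounded_measurable g ->
  (forall w w', (forall j, j != i -> w j = w' j) -> g w = g w') ->
  \int[mu]_w (heat_bath phi i h w * g w) = \int[mu]_w (h w * g w).
Proof.
move=> bh bg gi; pose X := {ffun [fset i]%fset -> S}.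
pose E (z : X) := [set w : config hS | forall l : [fset i]%fset, w (val l) = z l].
pose u (z : X) (w : config hS) := \1_(E z) w - gibbs_density phi z w.
have bE z : bounded_measurable (\1_(E z)).
  apply: bounded_measurable_indic; exact: measurable_cylinder.
have bu z : bounded_measurable (u z).
  by apply: bounded_measurableB => //; exact: bounded_measurable_density.
have bhz (z : X) : bounded_measurable (fun w => h (splice z w)).
  exact: bounded_measurable_splice.
apply/eqP; rewrite eq_sym -subr_eq0 -RintegralB_bounded; last 2 first.
- exact: bounded_measurableM.
- by apply: bounded_measurableM => //; exact: bounded_measurable_heat_bath.
(* Splitting [h] according to the spin at [i] turns the difference into a sum of
   terms in which the factor after [u z] ignores that spin, while [u z] is an
   indicator minus its conditional probability. *)
have -> : (fun w => h w * g w - heat_bath phi i h w * g w) =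
    (fun w => \sum_(z : X) u z w * (h (splice z w) * g w)).
  apply/funext => w; rewrite /u.
  under eq_bigr do rewrite mulrBl !mulrA.
  rewrite sumrB -!mulr_suml; congr (_ * _ - _).
  pose z0 : X := [ffun l => w (val l)].
  have wE z : (w \in E z) = (z == z0).
    apply/idP/eqP => [/set_mem wz|->].
      by apply/ffunP => l; rewrite ffunE wz.
    by apply/mem_set => l; rewrite ffunE.
  rewrite (bigD1 z0)//= big1 ?addr0 => [|z zz0].
    rewrite indicE wE eqxx mul1r splice_self// => l.
    by rewrite ffunE.
  by rewrite indicE wE (negPf zz0) mul0r.
rewrite Rintegral_sum_bounded => [|z]; last first.
  by apply: bounded_measurableM => //; exact: bounded_measurableM.
rewrite big1// => z _.
have [mhg [M hgM]] := bounded_measurableM (bhz z) bg.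
apply: (@Rintegral_orthogonal _ _ _ mu (outside hS [fset i]%fset) (u z)
  (fun w => h (splice z w) * g w) M) => //.
- exact: outside_measurable.
- by have [] := bu z.
- move=> w; rewrite /u indicE ler_norml.
  have := gibbs_density_ge0 phi z w; have := gibbs_density_le1 hS phi z w.
  by case: (_ \in _); rewrite /=; lra.
- move=> B GB; have mB := outside_measurable GB.
  have mE := measurable_cylinder hS z.
  have bB := bounded_measurable_indic R mB.
  rewrite (_ : (fun _ => _) =
      fun w => \1_(E z `&` B) w - gibbs_density phi z w * \1_B w); last first.
    by apply/funext => w; rewrite /u indicI mulrBl.
  rewrite RintegralB_bounded; last 2 first.
  + exact/bounded_measurable_indic/measurableI.
  + by apply: bounded_measurableM => //; exact: bounded_measurable_density.
  rewrite {1}/Rintegral integral_indic ?setIT//; last exact: measurableI.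
  rewrite [X in fine X]((mu_gibbs z).2 B GB).
  rewrite -[X in _ - X](_ : \int[mu]_(w in B) gibbs_density phi z w = _) ?subrr//.
  rewrite Rintegral_mkcond; congr Rintegral; apply/funext => w.
  by rewrite patch_indic.
- apply: outside_preimage => // w w' ww'.
  congr (h _ * _); last by apply: gi => j ji; apply: ww'; rewrite inE.
  apply/funext => j; case: (boolP (j \in [fset i]%fset)) => ji.
    exact: splice_in.
  by rewrite !splice_notin// ww'.
Qed.

End heat_bath_invariance.

(** * Repeated resampling *)

Section weighted_contraction.
Local Open Scope ereal_scope.
Variables (R : realType) (S : {fset R}) (hS : S != fset0).
Variables (phi : interaction S) (th al : R) (wt : int -> R).
Hypothesis al01 : (0 <= al < 1)%R.
Hypothesis coupling_sum : forall i : int,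
  \esum_(j in [set j | j != i])
    ((expR (th * `|i - j|%:~R))%:E * coupling phi i j) <= (2 * al)%:E.
Hypothesis wt_gt0 : forall j, (0 < wt j)%R.
Hypothesis wt_ratio : forall i j, (wt j <= expR (th * `|i - j|%:~R) * wt i)%R.

Definition weighted_sum (a : int -> \bar R) : \bar R :=
  \esum_(j in [set: int]) ((wt j)%:E * a j).

Lemma weighted_sumD1 (i : int) (a : int -> \bar R) : (forall j, 0 <= a j) ->
  weighted_sum a =
    \esum_(j in [set j | j != i]) ((wt j)%:E * a j) + (wt i)%:E * a i.
Proof.
move=> a0; have wa0 j : 0 <= (wt j)%:E * a j.
  by apply: mule_ge0 => //; rewrite lee_fin ltW.
rewrite /weighted_sum (esumID [set j | j != i])// !setTI; congr (_ + _).
rewrite (_ : ~` _ = [set i]) ?esum_set1//.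
apply/seteqP; split=> j /=; first by move=> /negP; rewrite negbK => /eqP.
by move=> ->; rewrite eqxx.
Qed.

Lemma heat_bath_bound_ge0 (i : int) (a : int -> \bar R) :
  (forall j, 0 <= a j) -> forall j, 0 <= heat_bath_bound phi i a j.
Proof.
move=> a0 j; rewrite /heat_bath_bound; case: ifP => // _.
by rewrite adde_ge0// !mule_ge0// coupling_ge0.
Qed.

(** Resampling [i] removes the weight of [i] and gives back at most the
    fraction [al] of it to the other sites. *)
Lemma weighted_sum_heat_bath (i : int) (a : int -> \bar R) :
  (forall j, 0 <= a j) ->
  weighted_sum (heat_bath_bound phi i a) + ((1 - al) * wt i)%:E * a i <=
  weighted_sum a.
Proof.
move=> a0; have /andP[al0 al1] := al01.
have wi0 := wt_gt0 i.
rewrite (weighted_sumD1 i (heat_bath_bound_ge0 i a0)) (weighted_sumD1 i a0).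
rewrite {2}/heat_bath_bound eqxx mule0 adde0.
have wa0 j : 0 <= (wt j)%:E * a j by apply: mule_ge0 => //; rewrite lee_fin ltW.
have ha0 : 0 <= 2^-1%:E * a i by rewrite mule_ge0.
rewrite (@eq_esum _ _ _ _ (fun j => (wt j)%:E * a j +
    (2^-1%:E * a i) * ((wt j)%:E * coupling phi i j))); last first.
  move=> j /= /negPf ji; rewrite /heat_bath_bound ji ge0_muleDr ?mule_ge0 ?coupling_ge0//.
  by congr (_ + _); rewrite [RHS]muleC -muleA.
have wc0 j : 0 <= (wt j)%:E * coupling phi i j.
  by rewrite mule_ge0 ?lee_fin ?(ltW (wt_gt0 _)) ?coupling_ge0.
rewrite esumD//; last by move=> j _; rewrite mule_ge0.
rewrite esumZl// -addeA leeD2l//.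
have -> : (wt i)%:E * a i = (al * wt i)%:E * a i + ((1 - al) * wt i)%:E * a i.
  rewrite -ge0_muleDl ?lee_fin ?mulr_ge0 ?subr_ge0 ?(ltW al1) ?(ltW wi0)//.
  by rewrite -EFinD -mulrDl addrC subrK mul1r.
apply: leeD2r.
have -> : (al * wt i)%:E * a i = (2^-1%:E * a i) * (wt i * (2 * al))%:E.
  rewrite muleAC -EFinM; congr (_%:E * _).
  by field.
apply: lee_wpmul2l => //.
rewrite EFinM; apply: le_trans (lee_wpmul2l _ (coupling_sum i)); last first.
  by rewrite lee_fin ltW.
rewrite -esumZl ?lee_fin ?(ltW (wt_gt0 _))//; last first.
  by move=> j _; rewrite mule_ge0 ?lee_fin ?expR_ge0 ?coupling_ge0.
apply: le_esum => j _; rewrite muleA; apply: lee_wpmul2r; first exact: coupling_ge0.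
by rewrite -EFinM lee_fin mulrC.
Qed.

End weighted_contraction.

Section sweeping.
Variables (R : realType) (S : {fset R}) (hS : S != fset0).
Variables (phi : interaction S) (mu : probability (config hS) R).
Variables (th al : R) (wt : int -> R).
Hypothesis phi_potential : is_potential phi.
Hypothesis mu_gibbs : is_gibbs phi mu.
Hypothesis al01 : (0 <= al < 1)%R.
Hypothesis coupling_sum : forall i : int,
  (\esum_(j in [set j | j != i])
    ((expR (th * `|i - j|%:~R))%:E * coupling phi i j) <= (2 * al)%:E)%E.
Hypothesis wt_gt0 : forall j, (0 < wt j)%R.
Hypothesis wt_ratio : forall i j, (wt j <= expR (th * `|i - j|%:~R) * wt i)%R.
Local Notation bounded_measurable := (@bounded_measurable _ (config hS) R).

Definition ignores (K : seq int) (g : config hS -> R) : Prop :=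
  forall w w', (forall j, j \notin K -> w j = w' j) -> g w = g w'.

(** [h] with Lipschitz bounds [b] is a stand-in for [f] against all
    observables that ignore the sites of [K]. *)
Definition substitute (K : seq int) (f : config hS -> R) (h : config hS -> R)
    (b : int -> \bar R) : Prop :=
  [/\ bounded_measurable h, forall j, (0 <= b j)%E, site_lipschitz h b &
   forall g, bounded_measurable g -> ignores K g ->
     \int[mu]_w (h w * g w) = \int[mu]_w (f w * g w)].

Lemma substitute_heat_bath K f h b (i : int) : i \in K ->
  substitute K f h b -> substitute K f (heat_bath phi i h) (heat_bath_bound phi i b).
Proof.
move=> iK [bh b0 hb hf]; split.
- exact: bounded_measurable_heat_bath.
- exact: heat_bath_bound_ge0.
- exact: heat_bath_lipschitz.
- move=> g bg gK; rewrite (heat_bath_invariance mu_gibbs)// ?hf// => w w' ww'.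
  by apply: gK => j jK; apply: ww'; apply: contraNneq jK => ->.
Qed.

(** As long as some site [i] of [K] has [wt i * b i > e], resampling it lowers
    the weighted sum by at least [(1 - al) * e], which can happen only finitely
    often. *)
Lemma exists_small_substitute K f a (e : R) : 0 < e ->
  substitute K f f a -> (weighted_sum wt a < +oo)%E ->
  exists h b, [/\ substitute K f h b, (weighted_sum wt b <= weighted_sum wt a)%E &
    forall i, i \in K -> ((wt i)%:E * b i <= e%:E)%E].
Proof.
move=> e0 sa aoo; have /andP[al0 al1] := al01.
have ws0 b : (forall j, (0 <= b j)%E) -> (0 <= weighted_sum wt b)%E.
  by move=> b0; apply: esum_ge0 => j _; rewrite mule_ge0 ?lee_fin ?(ltW (wt_gt0 _)).
have afin : weighted_sum wt a \is a fin_num.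
  by rewrite ge0_fin_numE// ws0//; case: sa.
apply: contrapT => none.
have step n : exists h b, substitute K f h b /\
    (weighted_sum wt b + (n%:R * ((1 - al) * e))%:E <= weighted_sum wt a)%E.
  elim: n => [|n [h [b [sb wb]]]].
    by exists f, a; rewrite mul0r adde0.
  have [b0 hb] : (forall j, (0 <= b j)%E) /\ site_lipschitz h b by case: sb.
  have [i [iK ie]] : exists i, i \in K /\ (e%:E <= (wt i)%:E * b i)%E.
    apply: contrapT => small; apply: none; exists h, b; split => //.
      apply: le_trans wb; rewrite leeDl// lee_fin !mulr_ge0// ?subr_ge0 ?(ltW al1) ?(ltW e0)//.
    move=> i iK; rewrite leNgt; apply/negP => ie; apply: small; exists i.
    by split=> //; exact: ltW.
  exists (heat_bath phi i h), (heat_bath_bound phi i b); split.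
    exact: substitute_heat_bath.
  have contraction :=
    weighted_sum_heat_bath hS al01 coupling_sum wt_gt0 wt_ratio i b0.
  apply: le_trans wb; apply: le_trans (leeD2r _ contraction).
  rewrite -addeA leeD2l// -natr1 mulrDl mul1r EFinD addeC leeD2r//.
  by rewrite !EFinM -muleA lee_wpmul2l// lee_fin subr_ge0 ltW.
pose n := (Num.trunc (fine (weighted_sum wt a) / ((1 - al) * e))).+1.
have [h [b [[_ b0 _ _]]]] := step n.
apply/negP; rewrite -ltNge -(fineK afin).
apply: (@lt_le_trans _ _ (n%:R * ((1 - al) * e))%:E); last first.
  by rewrite leeDr// ws0.
by rewrite lte_fin -ltr_pdivrMr ?mulr_gt0 ?subr_gt0// truncnS_gt.
Qed.

(** A covariance does not change when a constant is subtracted from [h]. *)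
Lemma covariance_oscillation (h g : config hS -> R) (D G : R) :
  bounded_measurable h -> bounded_measurable g ->
  (forall w w', `|h w - h w'| <= D) -> (forall w, `|g w| <= G) ->
  `|\int[mu]_w (h w * g w) - \int[mu]_w h w * \int[mu]_w g w| <= 2 * (D * G).
Proof.
move=> bh bg hD gG.
pose c := h point.
have bc : bounded_measurable (fun=> c) by exact: bounded_measurable_cst.
have bhc : bounded_measurable (fun w => h w - c) by exact: bounded_measurableB.
have intc : \int[mu]_w c = c.
  by rewrite Rintegral_cst// [X in fine X](probability_setT mu) mulr1.
have -> : \int[mu]_w (h w * g w) - \int[mu]_w h w * \int[mu]_w g w =
    \int[mu]_w ((h w - c) * g w) - \int[mu]_w (h w - c) * \int[mu]_w g w.
  rewrite [\int[mu]_w (h w - c)]RintegralB_bounded// intc.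
  rewrite (_ : (fun w => (h w - c) * g w) = fun w => h w * g w - c * g w); last first.
    by apply/funext => w; rewrite mulrBl.
  rewrite RintegralB_bounded ?RintegralZ_bounded//; last 2 first.
  - exact: bounded_measurableM.
  - exact: bounded_measurableM.
  by ring.
have hcD w : `|h w - c| <= D by exact: hD.
rewrite mulr2n mulrDl mul1r (le_trans (ler_normB _ _))// lerD//.
  apply: normr_Rintegral_le; first by have [] := bounded_measurableM bhc bg.
  by move=> w; rewrite normrM ler_pM.
rewrite normrM ler_pM//; apply: normr_Rintegral_le => //; first by have [] := bhc.
by have [] := bg.
Qed.

(** Replacing [f] by a substitute changes neither term of the covariance, and
    the total oscillation of the substitute is small: inside [K] because its
    bounds there are, and outside [K] because the weight is at least [1 / dl]
    there while the weighted sum has not increased. *)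
Lemma weighted_covariance_bound K f g a (A G dl : R) : uniq K ->
  substitute K f f a -> (weighted_sum wt a <= A%:E)%E ->
  bounded_measurable g -> ignores K g -> (forall w, `|g w| <= G) -> 0 <= dl ->
  (forall j, j \notin K -> 1 <= dl * wt j) ->
  `|\int[mu]_w (f w * g w) - \int[mu]_w f w * \int[mu]_w g w|
    <= 2 * (dl * A * G).
Proof.
move=> uK sa aA bg gK gG dl0 dlK.
apply/ler_addgt0Pr => e e0.
have G0 : 0 <= G by rewrite (le_trans _ (gG point)).
pose et := e / (2 * (G + 1)).
have et0 : 0 < et by rewrite divr_gt0// mulr_gt0// ltr_wpDl.
pose W := \sum_(i <- K) (wt i)^-1.
have W0 : 0 <= W by rewrite sumr_ge0// => i _; rewrite invr_ge0 ltW.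
have [h [b [[bh b0 hb hf] wb small]]] :
    exists h b, [/\ substitute K f h b, (weighted_sum wt b <= weighted_sum wt a)%E &
      forall i, i \in K -> ((wt i)%:E * b i <= (et / (W + 1))%:E)%E].
  apply: exists_small_substitute => //; first by rewrite divr_gt0// ltr_wpDl.
  by rewrite (le_lt_trans aA)// ltry.
have hD w w' : `|h w - h w'| <= dl * A + et.
  rewrite -lee_fin; apply: (le_trans (hb w w')).
  apply: (@le_trans _ _ (\esum_(j in [set: int]) b j)%E).
    exact: le_esum_subset.
  rewrite (esumID [set` K])// setTI addeC EFinD; apply: leeD.
    apply: (@le_trans _ _ (dl%:E * weighted_sum wt b)%E); last first.
      by rewrite EFinM lee_wpmul2l// (le_trans wb).
    rewrite -esumZl//; last by move=> j _; rewrite mule_ge0 ?lee_fin ?(ltW (wt_gt0 _)).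
    apply: (@le_trans _ _ (\esum_(j in [set: int] `&` ~` [set` K])
        (dl%:E * ((wt j)%:E * b j)))%E).
      apply: le_esum => j [_ /= /negP jK]; rewrite muleA -EFinM.
      by rewrite -[leLHS]mul1e lee_wpmul2r// -[1%E]/(1%:E) lee_fin dlK.
    by apply: le_esum_subset => // j; rewrite !mule_ge0 ?lee_fin ?(ltW (wt_gt0 _)).
  rewrite esum_seq//.
  apply: (@le_trans _ _ (\sum_(i <- K) ((wt i)^-1 * (et / (W + 1)))%:E)%E).
    rewrite big_seq [leRHS]big_seq; apply: lee_sum => i iK.
    have -> : (b i = (wt i)^-1%:E * ((wt i)%:E * b i))%E.
      by rewrite muleA -EFinM mulVf ?gt_eqF// mul1e.
    by rewrite EFinM; apply: lee_wpmul2l (small _ iK); rewrite lee_fin invr_ge0 ltW.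
  rewrite sumEFin lee_fin -mulr_suml -/W mulrCA -[leRHS]mulr1 ler_wpM2l ?(ltW et0)//.
  by rewrite ler_pdivrMr ?ltr_wpDl// mul1r lerDl.
have -> : \int[mu]_w (f w * g w) = \int[mu]_w (h w * g w) by rewrite hf.
have int1 (v : config hS -> R) : \int[mu]_w v w = \int[mu]_w (v w * 1).
  by congr Rintegral; apply/funext => w; rewrite mulr1.
have -> : \int[mu]_w f w = \int[mu]_w h w.
  by rewrite [LHS]int1 [RHS]int1 hf//; exact: bounded_measurable_cst.
apply: (le_trans (covariance_oscillation bh bg hD gG)).
rewrite [(_ + et) * G]mulrDl mulrDr lerD2l /et.
have -> : 2 * (e / (2 * (G + 1)) * G) = e * (G / (G + 1)).
  by field; rewrite gt_eqF// ltr_wpDl.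
by rewrite -[leRHS]mulr1 ler_wpM2l ?(ltW e0)// ler_pdivrMr ?ltr_wpDl// mul1r lerDl.
Qed.

End sweeping.

(** * Exponential decay of covariances *)

Definition depends_on (T : Type) (I : seq int) (R : Type) (f : (int -> T) -> R) :
    Prop :=
  forall w w', (forall j, j \in I -> w j = w' j) -> f w = f w'.

(** Besides the bounds of the observables, the constant only involves the number
    of sites of one of the two supports. *)
Definition exponential_mixing (R : realType) (S : {fset R}) (hS : S != fset0)
    (mu : probability (config hS) R) (th : R) : Prop :=
  forall (I J : seq int) (f g : config hS -> R) (A B : R) (d : nat),
  bounded_measurable f -> depends_on I f -> (forall w, `|f w| <= A) ->
  bounded_measurable g -> depends_on J g -> (forall w, `|g w| <= B) ->
  (forall n m, n \in I -> m \in J -> d%:Z <= `|n - m|) ->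
  `|\int[mu]_w (f w * g w) - \int[mu]_w f w * \int[mu]_w g w|
    <= 4 * (size I)%:R ^+ 2 * A * B * expR (- (th * d%:R)).

Section covariance_decay.
Variables (R : realType) (S : {fset R}) (hS : S != fset0).
Variables (phi : interaction S) (mu : probability (config hS) R).
Variables (th al : R).
Hypothesis phi_potential : is_potential phi.
Hypothesis mu_gibbs : is_gibbs phi mu.
Hypothesis th_ge0 : 0 <= th.
Hypothesis al01 : 0 <= al < 1.
Hypothesis coupling_sum : forall i : int,
  (\esum_(j in [set j | j != i])
    ((expR (th * `|i - j|%:~R))%:E * coupling phi i j) <= (2 * al)%:E)%E.
Local Notation bounded_measurable := (@bounded_measurable _ (config hS) R).

Lemma depends_on_lipschitz (I : seq int) (f : config hS -> R) (A : R) : 0 <= A ->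
  depends_on I f -> (forall w, `|f w| <= A) ->
  site_lipschitz f (fun j => if j \in I then (2 * A)%:E else 0%E).
Proof.
move=> A0 fI fA w w'; set a : int -> \bar R := fun j => if _ then _ else _.
have a0 j : (0 <= a j)%E by rewrite /a; case: ifP => // _; rewrite lee_fin mulr_ge0.
have [[j [jI wj]]|none] := pselect (exists j, j \in I /\ w j != w' j).
  apply: (@le_trans _ _ (a j)).
    rewrite /a jI lee_fin (le_trans (ler_normB _ _))//.
    by rewrite mulr2n mulrDl mul1r lerD.
  by rewrite -[leLHS](@esum_set1 R _ j a)//; apply: le_esum_subset => // _ ->.
have -> : f w = f w'.
  by apply: fI => j jI; apply/eqP/negPn/negP => wj; apply: none; exists j.
by rewrite subrr normr0; apply: esum_ge0 => j _; exact: a0.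
Qed.

(** The weight of a site is, up to the factor [size I], the exponential of its
    distance to [I]; this sum satisfies the ratio bound without a case
    distinction on the nearest point of [I]. *)
Definition decay_weight (I : seq int) (j : int) : R :=
  (\sum_(n <- I) expR (- (th * `|j - n|%:~R)))^-1.

Let decay_sum_ge (I : seq int) (j n : int) : n \in I ->
  expR (- (th * `|j - n|%:~R)) <= \sum_(n <- I) expR (- (th * `|j - n|%:~R)).
Proof.
move=> nI; rewrite (big_rem n)//= lerDl sumr_ge0// => m _; exact: expR_ge0.
Qed.

Lemma decay_weight_gt0 (I : seq int) (n j : int) : n \in I -> 0 < decay_weight I j.
Proof.
by move=> nI; rewrite invr_gt0 (lt_le_trans _ (decay_sum_ge j nI))// expR_gt0.
Qed.

Lemma decay_weight_ratio (I : seq int) (n i j : int) : n \in I ->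
  decay_weight I j <= expR (th * `|i - j|%:~R) * decay_weight I i.
Proof.
move=> nI; have := decay_weight_gt0 i nI; have := decay_weight_gt0 j nI.
rewrite /decay_weight !invr_gt0 => j0 i0.
rewrite -[leLHS]mul1r ler_pdivrMr// mulrAC ler_pdivlMr// mul1r mulr_sumr.
apply: ler_sum => m _; rewrite -expRD ler_expR.
have tri : `|j - m| <= `|i - j| + `|i - m| :> int by lia.
have : `|j - m|%:~R <= `|i - j|%:~R + `|i - m|%:~R :> R by rewrite -intrD ler_int.
by move=> /(ler_wpM2l th_ge0); lra.
Qed.

Lemma decay_weight_le1 (I : seq int) (n : int) : n \in I -> decay_weight I n <= 1.
Proof.
move=> nI; rewrite invf_le1; last by have := decay_weight_gt0 n nI; rewrite invr_gt0.
by have := decay_sum_ge n nI; rewrite subrr normr0 mulr0 oppr0 expR0.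
Qed.

Lemma decay_weight_far (I : seq int) (j n : int) (d : nat) : n \in I ->
  (forall m, m \in I -> d%:Z <= `|m - j|) ->
  1 <= (size I)%:R * expR (- (th * d%:R)) * decay_weight I j.
Proof.
move=> nI far; have := decay_weight_gt0 j nI; rewrite invr_gt0 => s0.
rewrite ler_pdivlMr// mul1r.
apply: (@le_trans _ _ (\sum_(m <- I) expR (- (th * d%:R)))).
  rewrite big_seq [leRHS]big_seq; apply: ler_sum => m mI.
  rewrite ler_expR lerN2 ler_wpM2l// -[d%:R]/(d%:Z%:~R) ler_int distrC.
  exact: far.
by rewrite big_const_seq count_predT iter_addr_0 mulr_natl.
Qed.

Definition neighbourhood (d : nat) (I : seq int) : seq int :=
  undup [seq n + (m%:Z - d%:Z) | n <- I, m <- iota 1 (d.*2.-1)].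

Lemma mem_neighbourhood (d : nat) (I : seq int) (j : int) :
  reflect (exists2 n, n \in I & `|n - j| < d%:Z) (j \in neighbourhood d I).
Proof.
rewrite mem_undup; apply: (iffP allpairsP) => /= [[[n m] /= [nI + ->]]|[n nI nj]].
  by rewrite mem_iota => mI; exists n => //; lia.
exists (n, absz (j - n + d%:Z)) => /=; split => //; last by lia.
rewrite mem_iota; lia.
Qed.

(** The sites to be resampled are those close to [I]: the others, in particular
    the sites of [J], carry a weight of at least [expR (th * d) / size I]. *)
Theorem covariance_decay : exponential_mixing mu th.
Proof.
move=> I J f g A B d.
move=> bf fI fA bg gJ gB far.
have A0 : 0 <= A by rewrite (le_trans _ (fA point)).
(* Without sites the weight would be [0], but then [f] is constant. *)
case: I => [|n0 I'] in fI far *; last set I := n0 :: I' in fI far *.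
  have -> : 4 * (size (@nil int))%:R ^+ 2 * A * B * expR (- (th * d%:R)) = 2 * (0 * B).
    by rewrite /= expr0n/=; ring.
  apply: covariance_oscillation => // w w'.
  by rewrite (fI w w')// subrr normr0.
have n0I : n0 \in I by rewrite mem_head.
pose a j := if j \in I then (2 * A)%:E else 0%E.
have a0 j : (0 <= a j)%E by rewrite /a; case: ifP => // _; rewrite lee_fin mulr_ge0.
have -> : 4 * (size I)%:R ^+ 2 * A * B * expR (- (th * d%:R)) =
    2 * ((size I)%:R * expR (- (th * d%:R)) * ((size I)%:R * (2 * A)) * B).
  by ring.
apply: (@weighted_covariance_bound _ _ _ phi mu th al (decay_weight I) phi_potential mu_gibbs al01
   coupling_sum _ _ (neighbourhood d I) f g a
  ((size I)%:R * (2 * A)) B ((size I)%:R * expR (- (th * d%:R)))).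
- by move=> j; exact: decay_weight_gt0 n0I.
- by move=> i j; exact: decay_weight_ratio n0I.
- exact: undup_uniq.
- by split=> //; exact: depends_on_lipschitz.
- rewrite /weighted_sum (eq_esum (b := fun j => if j \in [set` undup I]
      then (decay_weight I j * (2 * A))%:E else 0%E)); last first.
    move=> j _; rewrite /a mem_setE mem_undup; case: ifP => _.
      by rewrite EFinM.
    by rewrite mule0.
  rewrite -esum_mkcond esum_seq ?undup_uniq//; last first.
    move=> j; rewrite lee_fin !mulr_ge0//.
    by rewrite ltW// (decay_weight_gt0 _ n0I).
  rewrite sumEFin lee_fin.
  apply: (@le_trans _ _ (\sum_(j <- undup I) (2 * A))).
    rewrite big_seq [leRHS]big_seq; apply: ler_sum => j; rewrite mem_undup => jI.
    by rewrite -[leRHS]mul1r ler_wpM2r ?mulr_ge0// decay_weight_le1.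
  rewrite big_const_seq count_predT iter_addr_0 -[leLHS]mulr_natl.
  by rewrite ler_wpM2r ?mulr_ge0// ler_nat size_undup.
- exact: bg.
- move=> w w' ww'; apply: gJ => j jJ; apply: ww'.
  apply/negP => /mem_neighbourhood[n nI]; rewrite ltNge => /negP; apply.
  exact: far.
- exact: gB.
- by rewrite mulr_ge0// expR_ge0.
- move=> j jK; apply: (decay_weight_far n0I) => m mI.
  rewrite leNgt; apply/negP => mj; move/negP: jK; apply.
  by apply/mem_neighbourhood; exists m.
Qed.

End covariance_decay.

(** * Moments of the spins *)

Section spin_products.
Variables (R : realType) (S : {fset R}) (hS : S != fset0).
Variable mu : probability (config hS) R.
Local Notation bounded_measurable := (@bounded_measurable _ (config hS) R).

Definition spin_product (s : seq nat) (w : config hS) : R :=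
  \prod_(n <- s) spin n w.

Definition spin_bound : R := 1 + \sum_(s : S) `|val s|.

Lemma spin_bound_ge1 : 1 <= spin_bound.
Proof. by rewrite lerDl sumr_ge0. Qed.

Lemma normr_spin_le (n : nat) (w : config hS) : `|spin n w| <= spin_bound.
Proof.
rewrite /spin_bound (bigD1 (w n%:Z))//= addrCA lerDl addr_ge0//.
by rewrite sumr_ge0.
Qed.

Lemma bounded_measurable_spin (n : nat) : bounded_measurable (@spin R S hS n).
Proof.
rewrite (_ : @spin R S hS n =
    fun w => \sum_(s : S) val s * \1_[set w : config hS | w n%:Z = s] w).
  apply: bounded_measurable_sum => s; apply: bounded_measurableM.
    exact: bounded_measurable_cst.
  by apply: bounded_measurable_indic; exact: measurable_coord.
apply/funext => w; rewrite (bigD1 (w n%:Z))//= big1 => [|s sw].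
  by rewrite indicE mem_set// mulr1 addr0.
rewrite indicE memNset ?mulr0// => /= ws.
by move: sw; rewrite ws eqxx.
Qed.

Lemma bounded_measurable_spin_product s : bounded_measurable (spin_product s).
Proof. by apply: bounded_measurable_prod => n; exact: bounded_measurable_spin. Qed.

Lemma spin_product_cat s t w :
  spin_product (s ++ t) w = spin_product s w * spin_product t w.
Proof. exact: big_cat. Qed.

Lemma normr_spin_product_le s w : `|spin_product s w| <= spin_bound ^+ size s.
Proof.
elim: s => [|n s IHs]; first by rewrite /spin_product big_nil normr1.
by rewrite /spin_product big_cons normrM exprS ler_pM ?normr_spin_le.
Qed.

Lemma spin_product_depends_on s : depends_on (map Posz s) (spin_product s).
Proof.
move=> w w' ww'; rewrite /spin_product big_seq [RHS]big_seq.
by apply: eq_bigr => n ns; rewrite /spin ww'// map_f.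
Qed.

Lemma expectation_bounded (X : config hS -> R) :
  bounded_measurable X -> 'E_mu[X]%E = (\int[mu]_w X w)%:E.
Proof.
move=> bX; rewrite unlock /Rintegral fineK//.
by apply: integrable_fin_num => //; exact: bounded_measurable_integrable.
Qed.

Lemma momentE s : moment mu s = (\int[mu]_w spin_product s w)%:E.
Proof. exact: (expectation_bounded (bounded_measurable_spin_product s)). Qed.

End spin_products.

Lemma seq_min_le d (T : orderType d) (x0 x : T) (s : seq T) :
  x \in s -> (seq_min x0 s <= x)%O.
Proof. by move=> xs; rewrite /seq_min (ge_bigmin_seq _ _ xpredT). Qed.

Lemma index_dist_le (i j : seq nat) (n m : nat) : n \in i -> m \in j ->
  (index_dist i j <= absz (n%:Z - m%:Z))%N.
Proof.
move=> ni mj; rewrite -leEnat; apply: seq_min_le.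
by apply/allpairsP; exists (n, m).
Qed.

Lemma odd_spacing_le (i : seq nat) (a : nat) : (a.+1 < (size i)./2)%N ->
  (odd_spacing i <= nth 0 i a.+1.*2 - nth 0 i a.*2)%N.
Proof.
move=> ai; rewrite -leEnat; apply: seq_min_le; apply/mapP; exists a => //.
by rewrite mem_iota /=; move: ai; case: (size i)./2.
Qed.

Lemma exists_large_odd_gap (i : seq nat) : (1 < size i)%N ->
  exists2 a, (a.*2.+1 < size i)%N &
    (odd_gaps i <= size i * (nth 0 i a.*2.+1 - nth 0 i a.*2))%N.
Proof.
move=> i1; pose g (a : nat) := (nth 0 i a.*2.+1 - nth 0 i a.*2)%N.
have h0 : (0 < (size i)./2)%N by rewrite half_gt0.
have [a aE] : {a : 'I_(size i)./2 | \max_(b < (size i)./2) g b = g a}.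
  by apply: bigop.eq_bigmax; rewrite card_ord.
exists a.
  by have := ltn_ord a; have := odd_double_half (size i); lia.
rewrite /odd_gaps big_mkord.
apply: (@leq_trans (\sum_(b < (size i)./2) g a)).
  by apply: leq_sum => b _; rewrite -aE (bigop.leq_bigmax b).
by rewrite sum_nat_const card_ord leq_mul//; have := odd_double_half (size i); lia.
Qed.

Section moments.
Variables (R : realType) (S : {fset R}) (hS : S != fset0).
Variable mu : probability (config hS) R.
Variables (th : R) (k : nat).
Hypothesis th_gt0 : 0 < th.
Hypothesis k_gt0 : (0 < k)%N.
Hypothesis decay : exponential_mixing mu th.

(** Covers every pair of products of at most [k] spins. *)
Definition mixing_constant : R :=
  4 * k%:R ^+ 2 * spin_bound S ^+ k * spin_bound S ^+ k.

(** The rate [th] is divided by [k] because the first moment bound sees a single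
    gap, which is only guaranteed to be a fraction of the sum of all odd gaps. *)
Definition mixing_rate : R := expR (- (th / k%:R)).

Local Notation M := (spin_bound S).
Local Notation C0 := mixing_constant.
Local Notation beta := mixing_rate.

Lemma mixing_constant_ge0 : 0 <= C0.
Proof.
have M0 : 0 <= M := le_trans ler01 (spin_bound_ge1 S).
by rewrite !mulr_ge0// exprn_ge0.
Qed.

Lemma spin_product_covariance (s t : seq nat) (d : nat) :
  (size s <= k)%N -> (size t <= k)%N ->
  (forall n m, n \in s -> m \in t -> (d <= absz (n%:Z - m%:Z))%N) ->
  `|\int[mu]_w spin_product (s ++ t) w
     - \int[mu]_w spin_product s w * \int[mu]_w spin_product t w|
    <= C0 * expR (- (th * d%:R)).
Proof.
move=> sk tk far.
have M1 : 1 <= M := spin_bound_ge1 S.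
have bound u : (size u <= k)%N -> forall w : config hS, `|spin_product u w| <= M ^+ k.
  move=> uk w; apply: (le_trans (normr_spin_product_le u w)).
  exact: ler_weXn2l.
have -> : (fun w : config hS => spin_product (s ++ t) w) =
    fun w => spin_product s w * spin_product t w.
  by apply/funext => w; exact: spin_product_cat.
apply: (le_trans (decay (bounded_measurable_spin_product hS s)
  (@spin_product_depends_on _ _ hS s) (bound _ sk) (bounded_measurable_spin_product hS t)
  (@spin_product_depends_on _ _ hS t) (bound _ tk) _)).
  by move=> _ _ /mapP[n ns ->] /mapP[m mt ->]; rewrite -abszE lez_nat; exact: far.
rewrite ler_wpM2r ?expR_ge0// /mixing_constant size_map.
have Mk : 0 <= M ^+ k by rewrite exprn_ge0// (le_trans _ M1).
rewrite !ler_wpM2r// ler_wpM2l// lerXn2r ?nnegrE// ler_nat//.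
Qed.

Lemma expR_le_mixing_rate (d m : nat) : (m <= k * d)%N ->
  expR (- (th * d%:R)) <= beta ^+ m.
Proof.
move=> mkd; rewrite -expRM_natl ler_expR mulrN lerN2 mulrCA ler_pM2l//.
by rewrite ler_pdivrMr ?ltr0n// mulrC -natrM ler_nat.
Qed.

(** Cutting at the largest odd gap leaves an odd number of spins on either side,
    so that the moment is a covariance. *)
Lemma moment_le (i : seq nat) : ~~ odd k ->
  (forall s : seq nat, odd (size s) -> moment mu s = 0%E) ->
  size i = k -> sorted leq i ->
  (`|moment mu i| <= (C0 * beta ^+ odd_gaps i)%:E)%E.
Proof.
move=> k_even odd0 ik si.
have i1 : (1 < size i)%N by rewrite ik; move: k_gt0 k_even; case: k => [|[]].
have [a ai gap] := exists_large_odd_gap i1.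
pose s := take a.*2.+1 i; pose t := drop a.*2.+1 i.
have ss : size s = a.*2.+1 by rewrite size_takel// ltnW.
have st : size t = (k - a.*2.+1)%N by rewrite size_drop ik.
have s0 : \int[mu]_w spin_product s w = 0.
  by apply: EFin_inj; rewrite -momentE odd0// ss/= odd_double.
rewrite momentE -[X in spin_product X](cat_take_drop a.*2.+1 i) -/s -/t /= lee_fin.
pose d := (nth 0 i a.*2.+1 - nth 0 i a.*2)%N.
have := @spin_product_covariance s t d _ _ _.
rewrite s0 mul0r subr0; move=> /(_ _ _ _)/le_trans; apply.
- by rewrite ss -ik ltnW.
- by rewrite st leq_subr.
- move=> n m /(nthP 0%N)[p ps <-] /(nthP 0%N)[q qt <-].
  rewrite ss in ps; rewrite st in qt.
  rewrite /s /t nth_take// nth_drop.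
  have le1 : (nth 0 i p <= nth 0 i a.*2)%N.
    apply: (sorted_leq_nth leq_trans leqnn 0%N si); rewrite ?inE//; lia.
  have le2 : (nth 0 i a.*2.+1 <= nth 0 i (a.*2.+1 + q))%N.
    apply: (sorted_leq_nth leq_trans leqnn 0%N si); rewrite ?inE//; lia.
  have [ab|/ltnW] := leqP (nth 0%N i a.*2) (nth 0%N i a.*2.+1); last first.
    by rewrite -subn_eq0 /d => /eqP ->.
  by rewrite distnEr ?leq_sub// (leq_trans le1)// (leq_trans ab).
- by rewrite ler_wpM2l ?mixing_constant_ge0// expR_le_mixing_rate// -ik.
Qed.

Lemma product_moment_le (i j : seq nat) : size i = k -> size j = k ->
  (`|moment mu (i ++ j) - moment mu i * moment mu j|
     <= (C0 * beta ^+ index_dist i j)%:E)%E.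
Proof.
move=> ik jk; rewrite !momentE -EFinM -EFinB /= lee_fin.
have := @spin_product_covariance i j (index_dist i j) _ _ (@index_dist_le i j).
rewrite ik jk leqnn => /(_ isT isT)/le_trans; apply.
by rewrite ler_wpM2l ?mixing_constant_ge0// expR_le_mixing_rate// leq_pmull.
Qed.

(** Repeated indices turn squares of spins into a spin product. *)
Definition double_evens (i : seq nat) (m : nat) : seq nat :=
  flatten [seq [:: nth 0%N i a.*2; nth 0%N i a.*2] | a <- iota 0 m].

Lemma spin_product_double_evens i m (w : config hS) :
  spin_product (double_evens i m) w =
  \prod_(0 <= a < m) spin (nth 0%N i a.*2) w ^+ 2.
Proof.
rewrite /spin_product /double_evens big_flatten big_map/= /index_iota subn0.
by apply: eq_bigr => a _; rewrite !big_cons big_nil mulr1.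
Qed.

Lemma double_evensS i m : double_evens i m.+1 =
  double_evens i m ++ [:: nth 0%N i m.*2; nth 0%N i m.*2].
Proof.
by rewrite /double_evens -addn1 iotaD add0n map_cat flatten_cat.
Qed.

Lemma size_double_evens i m : size (double_evens i m) = m.*2.
Proof. by elim: m => // m IHm; rewrite double_evensS size_cat IHm addn2. Qed.

(** Removing the last square costs one covariance, since the expectation of a
    square is [1]. *)
Lemma square_product_le (i : seq nat) (m : nat) :
  (forall n : nat, ('E_mu[fun w => (spin n w ^+ 2)%R] = 1)%E) ->
  size i = k -> sorted leq i -> (m <= k./2)%N ->
  `|\int[mu]_w spin_product (double_evens i m) w - 1|
    <= m%:R * (C0 * beta ^+ odd_spacing i).
Proof.
move=> var1 ik si; elim: m => [|m IHm] mk.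
  rewrite mul0r (_ : (fun w => _) = fun=> 1).
    by rewrite Rintegral_cst// [X in fine X](probability_setT mu) mulr1 subrr normr0.
  by apply/funext => w; rewrite /spin_product big_nil.
set q := [:: nth 0%N i m.*2; nth 0%N i m.*2].
have q1 : \int[mu]_w spin_product q w = 1.
  apply: EFin_inj; rewrite -(var1 (nth 0%N i m.*2)) -momentE /moment.
  congr expectation; apply/funext => w.
  by rewrite !big_cons big_nil mulr1.
have mk2 : (m.*2.+1 < size i)%N.
  by rewrite ik; have := odd_double_half k; lia.
have far n p : n \in double_evens i m -> p \in q ->
    (odd_spacing i <= absz (n%:Z - p%:Z))%N.
  move=> /flattenP[_ /mapP[a + ->]]; rewrite mem_iota add0n /= => am.
  rewrite !inE orbb => /eqP -> /=; rewrite orbb => /eqP ->.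
  case: m am {IHm} mk mk2 q q1 => // m am mk mk2 q q1.
  have sp : (odd_spacing i <= nth 0 i m.+1.*2 - nth 0 i m.*2)%N.
    by apply: odd_spacing_le; rewrite ik.
  apply: (leq_trans sp).
  have le1 : (nth 0 i a.*2 <= nth 0 i m.*2)%N.
    apply: (sorted_leq_nth leq_trans leqnn 0%N si); rewrite ?inE; lia.
  have le2 : (nth 0 i m.*2 <= nth 0 i m.+1.*2)%N.
    apply: (sorted_leq_nth leq_trans leqnn 0%N si); rewrite ?inE; lia.
  by rewrite distnEr ?leq_sub// (leq_trans le1).
have := @spin_product_covariance (double_evens i m) q (odd_spacing i) _ _ far.
rewrite q1 mulr1 -double_evensS size_double_evens => /(_ _ _)cov.
rewrite -natr1 mulrDl mul1r.
rewrite -[X in `|X|](subrKA (\int[mu]_w spin_product (double_evens i m) w)).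
rewrite (le_trans (ler_normD _ _))// addrC lerD//; first exact/IHm/ltnW.
apply: (le_trans (cov _ _)).
- by have := odd_double_half k; lia.
- by have := odd_double_half k; rewrite /=; lia.
- by rewrite ler_wpM2l ?mixing_constant_ge0// expR_le_mixing_rate// leq_pmull.
Qed.

End moments.

Theorem lemma3p3 (R : realType) (S : {fset R}) (hS : S != fset0)
    (phi : interaction S) (mu : probability (config hS) R) (t : R)
    (phi_potential : is_potential phi)
    (phi_shift : shift_invariant phi)
    (mu_gibbs : is_gibbs phi mu)
    (odd_moments : forall i : seq nat, odd (size i) -> moment mu i = 0%E)
    (unit_variance :
      forall n : nat, ('E_mu[fun w => (spin n w ^+ 2)%R] = 1)%E)
    (dobrushin :
      (\esum_(A in [set A : {fset int} | (0 : int) \in A])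
         ((#|` A|%:R - 1)%:E * oscillation phi A) < 2%:E)%E)
    (t_gt0 : 0 < t)
    (exp_summable :
      (\esum_(A in [set A : {fset int} | (0 : int) \in A])
         ((expR (t * (diam A)%:~R) * (#|` A|%:R - 1))%:E * oscillation phi A)
       < +oo)%E) :
  forall k : nat, (0 < k)%N -> ~~ odd k ->
  exists C beta : R, [/\ 0 < C, 0 <= beta < 1 &
    forall i : seq nat, size i = k -> sorted leq i ->
    [/\ (`|moment mu i| <= (C * beta ^+ odd_gaps i)%:E)%E,
        forall j : seq nat, size j = k -> sorted leq j ->
          (`|moment mu (i ++ j) - moment mu i * moment mu j|
             <= (C * beta ^+ index_dist i j)%:E)%E &
        let squares :=
          ('E_mu[fun w =>
             (\prod_(0 <= a < k./2) spin (nth 0%N i a.*2) w ^+ 2)%R])%E in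
        if k == 2 then squares = 1%E
        else (`|squares - 1| <= (C * beta ^+ odd_spacing i)%:E)%E]].
Proof.
move=> k k_gt0 k_even.
have [th [al [th0 al01 csum]]] :=
  weighted_coupling_lt hS phi_shift t_gt0 dobrushin exp_summable.
have decay : exponential_mixing mu th :=
  covariance_decay phi_potential mu_gibbs (ltW th0) al01 csum.
pose C0 := mixing_constant S k.
have C00 : 0 <= C0 := mixing_constant_ge0 S k.
pose beta := mixing_rate th k.
(* The last estimate adds up one covariance for each of the [k / 2] squares. *)
pose C := 1 + k%:R * C0.
have C0C : C0 <= C.
  by rewrite /C -[leLHS]mul1r ler_wpDl// ler_wpM2r// ler1n.
have beta0 : 0 <= beta by exact: expR_ge0.
have bound n : ((C0 * beta ^+ n)%:E <= (C * beta ^+ n)%:E)%E.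
  by rewrite lee_fin ler_wpM2r// exprn_ge0.
exists C, beta; split.
- by rewrite ltr_wpDr// mulr_ge0.
- by rewrite beta0 -expR0 ltr_expR oppr_lt0 divr_gt0 ?ltr0n.
move=> i ik si; split.
- exact: (le_trans (moment_le th0 k_gt0 decay k_even odd_moments ik si)).
- move=> j jk sj; exact: (le_trans (product_moment_le th0 k_gt0 decay ik jk)).
case: eqVneq => [k2|_].
  rewrite -(unit_variance (nth 0%N i 0)); congr expectation.
  by apply/funext => w; rewrite k2 big_nat1.
rewrite (_ : (fun w => _) = spin_product (double_evens i k./2)); last first.
  by apply/funext => w; rewrite spin_product_double_evens.
rewrite -[expectation _ _]/(moment mu _) momentE /= lee_fin.
apply: (le_trans (square_product_le th0 k_gt0 decay unit_variance ik si (leqnn _))).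
rewrite mulrA ler_wpM2r ?exprn_ge0// /C ler_wpDl// ler_wpM2r// ler_nat.
by have := odd_double_half k; lia.
Qed.
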